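(* Let $G$ be a countable group, and $G\curvearrowright X$ a faithful extreme boundary action, where $X$ is Hausdorff. Then $G$ is $C^\ast$-simple if and only if one of the following possibilities holds: (i) the action $G\curvearrowright X$ is topologically free; (ii) the point stabilizers of the action $G\curvearrowright X$ are non-amenable.
   Context: Actions are by homeomorphisms. A subset $Y\subset X$ is compressible if there exists $x\in X$ such that for every open $U\subset X$ containing $x$ there is $g\in G$ with $g(Y)\subset U$. The action is extremely proximal if every closed $C\subset X$ with $C\neq X$ is compressible; minimal if every orbit is dense. An extreme boundary action is an action on a compact space that is minimal and extremely proximal. The action is topologically free if for every non-trivial $g\in G$ the fixed point set $\mathrm{Fix}(g)$ has empty interior. A group $G$ is $C^\ast$-simple if its reduced $C^\ast$-algebra is simple.
   Formalization: The formal theorem additionally assumes that X does not have exactly two points; the only excluded case is Z/2 swapping two points, a faithful, topologically free extreme boundary action of a group that is not C*-simple, where the claim fails. *)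

(* Defs.v *)
From HB Require Import structures.
From mathcomp Require Import all_boot all_order all_algebra.
From mathcomp Require Import all_classical all_reals all_analysis.
From mathcomp Require Import complex ring.

Set Implicit Arguments.
Unset Strict Implicit.
Unset Printing Implicit Defensive.

Import Order.TTheory GRing.Theory Num.Theory.
Import Normc.
Local Open Scope classical_set_scope.
Local Open Scope ring_scope.

Section Actions.
Variables (G : groupType) (X : topologicalType) (act : G -> X -> X).

(* Each [act g] is a homeomorphism, with continuous inverse [act g^-1]. *)
Definition continuous_action :=
  [/\ forall x, act 1%g x = x,
      forall g h x, act (g * h)%g x = act g (act h x)
    & forall g, continuous (act g)].

Definition act_orbit (x : X) : set X := [set act g x | g in [set: G]].

Definition stabilizer (x : X) : set G := [set g | act g x = x].

Definition Fix (g : G) : set X := [set x | act g x = x].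

Definition faithful_action := forall g, Fix g = setT -> g = 1%g.

Definition minimal_action := forall x, dense (act_orbit x).

Definition compressible (Y : set X) :=
  exists x : X, forall U : set X, open U -> U x ->
    exists g : G, act g @` Y `<=` U.

Definition extremely_proximal :=
  forall C : set X, closed C -> C <> setT -> compressible C.

(* A two-point [X] is allowed here.  It is degenerate: Z/2 swapping two points
   is a faithful, topologically free extreme boundary action, although the
   action is not strongly proximal and Z/2 is amenable. *)
Definition extreme_boundary :=
  [/\ compact [set: X], minimal_action & extremely_proximal].

Definition topologically_free :=
  forall g : G, g <> 1%g -> interior (Fix g) = set0.

End Actions.

(* Amenability of a subgroup [H] as a discrete group: there is a left-invariant
   finitely additive probability measure on all subsets of [H].  The values of
   [m] on sets not contained in [H] are irrelevant. *)
Definition amenable (R : realType) (G : groupType) (H : set G) :=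
  exists m : set G -> R,
    [/\ forall A, A `<=` H -> 0 <= m A,
        m H = 1,
        forall A B, A `<=` H -> B `<=` H -> A `&` B = set0 ->
          m (A `|` B) = m A + m B
      & forall h A, H h -> A `<=` H -> m [set (h * a)%g | a in A] = m A].

Section EllTwo.
Variables (R : realType) (G : groupType).

Definition sqnorm2 (f : G -> R[i]) : \bar R :=
  (\esum_(g in [set: G]) (normc (f g) ^+ 2)%:E)%E.

Definition l2 : {pred G -> R[i]^o} := [pred f | (sqnorm2 f < +oo)%E].

Lemma l2_submod_closed : submod_closed l2.
Proof.
split.
  rewrite inE /= /sqnorm2 esum1 ?ltry// => g _.
  by rewrite [_ g]/(0 : R[i]) normc0 expr0n.
move=> a f g; rewrite !inE /= => f2 g2.
pose K : R := 2 * normc a ^+ 2.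
have K0 : 0 <= K by rewrite mulr_ge0 ?sqr_ge0.
have esumZ (k : R) (u : G -> R[i]) : 0 <= k -> (sqnorm2 u < +oo)%E ->
    (\esum_(x in [set: G]) (k * normc (u x) ^+ 2)%:E < +oo)%E.
  move=> k0 u2.
  have u0 : (0 <= sqnorm2 u)%E by apply: esum_ge0 => x _; rewrite lee_fin sqr_ge0.
  apply: (@le_lt_trans _ _ (k%:E * sqnorm2 u)%E); last first.
    by apply: lte_mul_pinfty.
  apply: ge_ereal_sup => _ [F [Ffin FT] <-].
  under eq_fsbigr do rewrite EFinM.
  rewrite -ge0_mule_fsumr; last by move=> x; rewrite lee_fin sqr_ge0.
  apply: lee_pmul => //.
    by apply: fsume_ge0 => x _; rewrite lee_fin sqr_ge0.
  by apply: ereal_sup_ubound; exists F.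
apply: (@le_lt_trans _ _ (\esum_(x in [set: G])
   ((K * normc (f x) ^+ 2)%:E + (2 * normc (g x) ^+ 2)%:E))%E).
  apply: le_esum => x _; rewrite -EFinD lee_fin.
  have -> : (a *: f + g) x = a * f x + g x by [].
  have := le_normcD (a * f x) (g x).
  rewrite normcM /K => h.
  have nn (z : R[i]) : 0 <= normc z by case: z => ? ?; exact: sqrtr_ge0.
  apply: (@le_trans _ _ ((normc a * normc (f x) + normc (g x)) ^+ 2)).
    by rewrite lerXn2r// nnegrE ?addr_ge0 ?mulr_ge0.
  have := sqr_ge0 (normc a * normc (f x) - normc (g x)).
  rewrite -subr_ge0 => h2; rewrite -subr_ge0; apply: le_trans h2 _.
  by rewrite le_eqVlt; apply/orP; left; apply/eqP; ring.
rewrite esumD; first by rewrite lte_add_pinfty// esumZ.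
  by move=> x _; rewrite lee_fin mulr_ge0 ?sqr_ge0.
by move=> x _; rewrite lee_fin mulr_ge0 ?sqr_ge0.
Qed.

HB.instance Definition _ :=
  GRing.isSubmodClosed.Build _ _ l2 l2_submod_closed.

Record ell2 := Ell2 { ell2_val :> G -> R[i]^o ; _ : ell2_val \in l2 }.

HB.instance Definition _ := [isSub for ell2_val].
HB.instance Definition _ := [Choice of ell2 by <:].
HB.instance Definition _ := [SubChoice_isSubLmodule of ell2 by <:].

Definition l2norm (f : ell2) : R := Num.sqrt (fine (sqnorm2 f)).

Lemma translate_l2 (s : G) (f : ell2) :
  (fun g => ell2_val f (s^-1 * g)%g) \in l2.
Proof.
have : ell2_val f \in l2 by case: f.
rewrite !inE /= /sqnorm2.
rewrite (@reindex_esum _ _ _ [set: G] [set: G] (fun g => (s^-1 * g)%g))//.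
split=> //.
- by move=> x y _ _ /mulgI.
- by move=> x _; exists (s * x)%g => //; rewrite mulKg.
Qed.

(* The left regular representation. *)
Definition lambda (s : G) (f : ell2) : ell2 := Ell2 (translate_l2 s f).

(* Operators are functions [ell2 -> ell2], with their pointwise linear
   structure over [R[i]]. *)
Definition bounded_operator (T : ell2 -> ell2) :=
  linear T /\ exists M : R, forall f, l2norm (T f) <= M * l2norm f.

(* Only meaningful on bounded operators. *)
Definition opnorm (T : ell2 -> ell2) : R :=
  sup [set l2norm (T f) | f in [set f | l2norm f <= 1]].

(* Closure of a set of bounded operators in the operator norm. *)
Definition opclosure (S : set (ell2 -> ell2)) : set (ell2 -> ell2) :=
  [set T | bounded_operator T /\
     forall e : R, 0 < e -> exists2 U, S U & opnorm (T - U) < e].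

(* The linear span of the [lambda s]; it is a *-algebra since
   [lambda (s * t) = lambda s \o lambda t] and [lambda s^-1] is the adjoint of
   [lambda s]. *)
Definition regular_group_algebra : set (ell2 -> ell2) :=
  [set T | exists c : seq (R[i] * G), T = \sum_(p <- c) p.1 *: lambda p.2].

Definition reduced_Cstar_algebra : set (ell2 -> ell2) :=
  opclosure regular_group_algebra.

Definition closed_two_sided_ideal (A I : set (ell2 -> ell2)) :=
  [/\ I `<=` A,
      I 0 /\ (forall (a : R[i]) S T, I S -> I T -> I (a *: S + T)),
      forall S T, A S -> I T -> I (S \o T) /\ I (T \o S)
    & opclosure I `<=` I].

Definition simple_operator_algebra (A : set (ell2 -> ell2)) :=
  A <> [set 0] /\
  forall I, closed_two_sided_ideal A I -> I = [set 0] \/ I = A.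

End EllTwo.

Definition Cstar_simple (R : realType) (G : groupType) :=
  simple_operator_algebra (@reduced_Cstar_algebra R G).

(* Main.v *)
Require Import Defs.
From HB Require Import structures.
From mathcomp Require Import all_boot all_order all_algebra.
From mathcomp Require Import all_classical all_reals all_analysis.
From mathcomp Require Import complex ring lra.

Set Implicit Arguments.
Unset Strict Implicit.
Unset Printing Implicit Defensive.

Import Order.TTheory GRing.Theory Num.Theory.
Import numFieldNormedType.Exports.
Import Normc.
Local Open Scope classical_set_scope.
Local Open Scope ring_scope.

(** Both implications are proved by direct estimates in [ell2].

   Suppose that the action is not topologically free and that the stabilizer
   [H] of some point [x] is amenable.  A nontrivial [g] fixing an open set [U]
   pointwise has, by extreme proximality, a conjugate [h] supported in [U], so
   every point of [X] is fixed by [g] or by [h], and [(1 - g) (1 - h)] acts as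
   zero on functions on [X] ([complementary_fixed_points]).  The elements of the
   group algebra acting as zero on functions on [X] have as closure a nonzero
   ideal of the reduced algebra.  It is proper: amenability of [H] yields unit
   vectors supported in [H] which are almost invariant under finitely many
   elements of [H] ([amenable_almost_invariant]), and testing on these vectors
   shows that the ideal keeps distance [1] from the identity
   ([id_notin_permutation_kernel]).  The vectors are obtained by Day's argument:
   if they did not exist, a Hahn-Banach separation in [ell1] would give bounded
   functions on [H] whose total drift under finitely many translations is
   bounded below, which the invariant mean forbids.

   Conversely, the reduced algebra is simple as soon as finitely many nontrivial
   elements can be made simultaneously small by averaging over conjugates
   ([averaging_Cstar_simple]): averaging an element of an ideal then approximates
   its trace, and a nonzero ideal contains an element with nonzero trace.

   If the action is topologically free, finitely many nontrivial elements all
   move some open set [U] off itself.  When [G] is nontrivial,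
   [X] has at least three points and hence, by extreme proximality, no isolated
   point, so it contains arbitrarily many disjoint open sets; the complement of
   [U] can be compressed into each of them, which is the situation of Powers'
   estimate ([powers_estimate]).

   If all stabilizers are non-amenable, a Baire category argument, in which the
   countability of [G] enters, gives a point [x] such that each element of its
   stabilizer fixes a neighbourhood of [x].  Those elements are, finitely many
   at a time, conjugate into the rigid stabilizer of any given open set, hence
   rigid stabilizers are non-amenable ([rigid_not_almost_invariant]) and averages
   over suitable finite families in them have small norm.  If [t] moves [U] off
   itself and [g] is supported in [U], then [g t g^-1 = g (t g^-1 t^-1) t], where
   the middle factor commutes with everything supported in [U]; such factors do
   not spoil the smallness of an average of positive coefficients
   ([commuting_contraction]), so averaging over conjugates by elements supported
   in [U] makes [t] small.  The same average leaves alone the elements which fix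
   [U] pointwise, and after shrinking [U] these are the only two cases, so
   finitely many elements can be treated one after the other
   ([rigid_averaging_property]). *)

(** * The Hilbert space of square-summable functions *)

Section ComplexModulus.
Variable R : realType.
Implicit Types z w : R[i].

Lemma normc_ge0 z : 0 <= normc z.
Proof. by case: z => a b; exact: sqrtr_ge0. Qed.

Lemma normc_sqr z : normc z ^+ 2 = complex.Re z ^+ 2 + complex.Im z ^+ 2.
Proof. by case: z => a b /=; rewrite sqr_sqrtr// addr_ge0// sqr_ge0. Qed.

Lemma normcD_le z w : normc (z + w) <= normc z + normc w.
Proof. exact: le_normcD. Qed.

Lemma normcNE z : normc (- z) = normc z.
Proof. exact: normcN. Qed.

Lemma normc_real (a : R) : normc (a%:C)%C = `|a|.
Proof. by rewrite /normc /= expr0n /= addr0 sqrtr_sqr. Qed.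

End ComplexModulus.

Section EllTwoNorm.
Variables (R : realType) (G : groupType).
Notation E := (ell2 R G).
Notation N := (@l2norm R G).
Implicit Types (f g : E) (T U : E -> E) (s t x y : G).

Lemma ell2_eq f g : (forall x, f x = g x) -> f = g.
Proof. by move=> fg; apply: val_inj; apply/funext. Qed.

Lemma ell2D f g x : (f + g) x = f x + g x. Proof. by []. Qed.
Lemma ell2B f g x : (f - g) x = f x - g x. Proof. by []. Qed.
Lemma ell2Z (a : R[i]) f x : (a *: f) x = a * f x. Proof. by []. Qed.
Lemma ell20 x : (0 : E) x = 0. Proof. by []. Qed.

Lemma ell2_sum (I : Type) (s : seq I) (F : I -> E) x :
  (\sum_(i <- s) F i) x = \sum_(i <- s) F i x.
Proof. by elim/big_ind2: _ => // a1 a2 b1 b2 <- <-. Qed.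

Lemma lambdaE s f x : lambda s f x = f (s^-1 * x)%g. Proof. by []. Qed.

Lemma normc2_ge0 (F : G -> R[i]) x : (0 <= (normc (F x) ^+ 2)%:E)%E.
Proof. by rewrite lee_fin sqr_ge0. Qed.
Hint Resolve normc2_ge0 : core.

Lemma esum_indicator x : (\esum_(y in [set: G]) ((y == x)%:R : R)%:E = 1)%E.
Proof.
rewrite (@eq_esum _ _ _ _ (fun y => if y \in [set x] then 1%E else 0%E : \bar R)).
  by rewrite -esum_mkcond esum_set1.
move=> y _; have -> : (y \in [set x]) = (y == x).
  by apply/idP/idP; rewrite inE => /eqP.
by case: eqP.
Qed.

Lemma sqnorm2_ge0 (F : G -> R[i]) : (0 <= sqnorm2 F)%E.
Proof. by apply: esum_ge0 => x _; exact: normc2_ge0. Qed.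

Lemma sqnorm2_lty f : (sqnorm2 f < +oo)%E.
Proof. by case: f => f /= h; rewrite inE in h. Qed.

Lemma l2norm_ge0 f : 0 <= N f. Proof. exact: sqrtr_ge0. Qed.
Hint Resolve l2norm_ge0 : core.

Lemma l2norm_sqr f : (N f ^+ 2)%:E = sqnorm2 f.
Proof.
rewrite /l2norm sqr_sqrtr ?fine_ge0 ?sqnorm2_ge0// fineK//.
by rewrite ge0_fin_numE ?sqnorm2_ge0// sqnorm2_lty.
Qed.

Lemma l2norm_le f (M : R) : 0 <= M -> (sqnorm2 f <= (M ^+ 2)%:E)%E -> N f <= M.
Proof. by move=> M0; rewrite -l2norm_sqr lee_fin ler_pXn2r// nnegrE. Qed.

Lemma normc_le_l2norm f x : normc (f x) <= N f.
Proof.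
rewrite -(@ler_pXn2r _ 2)// ?nnegrE ?normc_ge0// -lee_fin l2norm_sqr.
apply: esum_ge; exists [set x]; first by split=> //; exact: finite_set1.
by rewrite fsbig_set1.
Qed.

Lemma l2norm_mono f g : (forall x, normc (f x) <= normc (g x)) -> N f <= N g.
Proof.
move=> fg; apply: l2norm_le => //; rewrite l2norm_sqr.
by apply: le_esum => x _; rewrite lee_fin ler_pXn2r ?nnegrE ?normc_ge0.
Qed.

Lemma sqnorm2Z (a : R) f : 0 <= a ->
  (\esum_(x in [set: G]) (a * normc (f x) ^+ 2)%:E)%E = (a * N f ^+ 2)%:E.
Proof.
move=> a0; have le1 (b : R) : 0 <= b ->
   (\esum_(x in [set: G]) (b * normc (f x) ^+ 2)%:E <= (b * N f ^+ 2)%:E)%E.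
  move=> b0; apply: ge_ereal_sup => _ [F [Ffin FT] <-].
  under eq_fsbigr do rewrite EFinM.
  rewrite -ge0_mule_fsumr// EFinM l2norm_sqr.
  by apply: lee_wpmul2l; rewrite ?lee_fin//; apply: ereal_sup_ubound; exists F.
apply/eqP; rewrite eq_le le1//=.
have [->|an0] := eqVneq a 0.
  by rewrite mul0r; apply: esum_ge0 => x _; rewrite mul0r.
have {an0}a0 : 0 < a by rewrite lt_neqAle eq_sym an0.
rewrite EFinM l2norm_sqr -lee_pdivlMl//.
apply: ge_ereal_sup => _ [F [Ffin FT] <-].
rewrite lee_pdivlMl// ge0_mule_fsumr//.
by apply: esum_ge; exists F.
Qed.

(** Minkowski's inequality.  With [a] and [b] slightly larger than the two
   norms, Young's inequality with the weights [b / a] and [a / b] bounds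
   [|f + g|^2] pointwise by [(1 + b / a) |f|^2 + (1 + a / b) |g|^2], and these
   weights are those for which the sum of the right-hand side is at most
   [(a + b)^2]. *)
Lemma ler_l2normD f g : N (f + g) <= N f + N g.
Proof.
suff key (e : R) : 0 < e -> N (f + g) <= (N f + e) + (N g + e).
  apply/ler_addgt0Pr => e e0; have := key _ (divr_gt0 e0 (ltr0Sn _ 1)).
  by rewrite addrACA -splitr.
move=> e0; set a := N f + e; set b := N g + e.
have a0 : 0 < a by rewrite ltr_wpDl.
have b0 : 0 < b by rewrite ltr_wpDl.
have ba0 : 0 < b / a by rewrite divr_gt0.
have ab0 : 0 < a / b by rewrite divr_gt0.
apply: l2norm_le; first by rewrite addr_ge0// ltW.
apply: (@le_trans _ _ (\esum_(x in [set: G])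
   (((1 + b / a) * normc (f x) ^+ 2)%:E + ((1 + a / b) * normc (g x) ^+ 2)%:E))%E).
  apply: le_esum => x _; rewrite ell2D -EFinD lee_fin.
  have h := normcD_le (f x) (g x).
  apply: (@le_trans _ _ ((normc (f x) + normc (g x)) ^+ 2)).
    by rewrite lerXn2r// nnegrE ?addr_ge0 ?normc_ge0.
  set u := normc (f x); set v := normc (g x).
  have -> : (1 + b / a) * u ^+ 2 + (1 + a / b) * v ^+ 2
     = (u + v) ^+ 2 + (a / b) * (b / a * u - v) ^+ 2.
    by field; rewrite !gt_eqF.
  by rewrite lerDl mulr_ge0 ?sqr_ge0// ltW.
rewrite esumD; last first.
- by move=> x _; rewrite lee_fin mulr_ge0 ?sqr_ge0// addr_ge0// ltW.
- by move=> x _; rewrite lee_fin mulr_ge0 ?sqr_ge0// addr_ge0// ltW.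
have c0 : 0 <= 1 + b / a by rewrite addr_ge0// ltW.
have d0 : 0 <= 1 + a / b by rewrite addr_ge0// ltW.
rewrite !sqnorm2Z// -EFinD lee_fin.
have -> : (a + b) ^+ 2 = (1 + b / a) * a ^+ 2 + (1 + a / b) * b ^+ 2.
  by field; rewrite !gt_eqF.
have sqD (u : R) : 0 <= u -> u ^+ 2 <= (u + e) ^+ 2.
  by move=> u0; rewrite lerXn2r ?nnegrE ?addr_ge0 ?lerDl// ltW.
by apply: lerD; apply: ler_wpM2l => //; exact: sqD.
Qed.

Lemma l2normZ (a : R[i]) f : N (a *: f) = normc a * N f.
Proof.
apply/eqP; rewrite -(@eqrXn2 _ 2)// ?mulr_ge0 ?normc_ge0//; apply/eqP.
apply: EFin_inj; rewrite l2norm_sqr exprMn -sqnorm2Z ?sqr_ge0//.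
by apply: eq_esum => x _; rewrite ell2Z normcM exprMn.
Qed.

Lemma l2normN f : N (- f) = N f.
Proof. by rewrite -scaleN1r l2normZ normcNE normc1 mul1r. Qed.

Lemma l2norm0 : N 0 = 0.
Proof. by rewrite -(scale0r 0) l2normZ normc0 mul0r. Qed.

Lemma l2norm_eq0 f : N f = 0 -> f = 0.
Proof.
move=> f0; apply: ell2_eq => x; apply: eq0_normc; apply/eqP.
by rewrite eq_le normc_ge0 -[X in _ <= X]f0 normc_le_l2norm.
Qed.

Lemma l2normBC f g : N (f - g) = N (g - f).
Proof. by rewrite -l2normN opprB. Qed.

Lemma ler_l2norm_sum (I : Type) (s : seq I) (F : I -> E) :
  N (\sum_(i <- s) F i) <= \sum_(i <- s) N (F i).
Proof.
elim/big_ind2: _ => [|x1 x2 y1 y2 h1 h2|//]; first by rewrite l2norm0.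
exact: le_trans (ler_l2normD _ _) (lerD h1 h2).
Qed.

Lemma ler_l2norm_dist f g : `|N f - N g| <= N (f - g).
Proof.
have h u v : N u - N v <= N (u - v).
  by rewrite lerBlDr; rewrite -[X in N X <= _](subrK v) ler_l2normD.
by rewrite ler_norml h andbT lerNl opprB l2normBC h.
Qed.

Lemma l2_parallelogram f g :
  N (f + g) ^+ 2 + N (f - g) ^+ 2 = 2 * N f ^+ 2 + 2 * N g ^+ 2.
Proof.
apply: EFin_inj; rewrite !EFinD -!sqnorm2Z// !l2norm_sqr.
rewrite -!esumD//; try by move=> x _; rewrite lee_fin mulr_ge0 ?sqr_ge0.
apply: eq_esum => x _; rewrite -!EFinD; congr (_%:E).
rewrite ell2D ell2B !normc_sqr.
by case: (f x) => a b; case: (g x) => c d /=; ring.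
Qed.

Lemma l2norm_lambda s f : N (lambda s f) = N f.
Proof.
congr (Num.sqrt (fine _)); rewrite /sqnorm2.
rewrite [RHS](@reindex_esum _ _ _ [set: G] [set: G] (fun x => (s^-1 * x)%g))//.
split=> //; first by move=> x y _ _ /mulgI.
by move=> x _; exists (s * x)%g => //; rewrite mulKg.
Qed.

Lemma lambdaM s t f : lambda (s * t) f = lambda s (lambda t f).
Proof. by apply: ell2_eq => x; rewrite !lambdaE invgM mulgA. Qed.

Lemma lambda1 f : lambda 1 f = f.
Proof. by apply: ell2_eq => x; rewrite lambdaE invg1 mul1g. Qed.

Lemma lambda_is_linear s : linear (@lambda R G s).
Proof. by move=> a f g; apply: ell2_eq. Qed.

HB.instance Definition _ s :=
  GRing.isLinear.Build _ _ _ _ (@lambda R G s) (@lambda_is_linear s).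

Fact restr_subproof (A : set G) f :
  (fun x => if x \in A then f x else 0 : R[i]^o) \in @l2 R G.
Proof.
rewrite inE /=; apply: le_lt_trans (sqnorm2_lty f).
by apply: le_esum => x _; case: ifP => // _; rewrite normc0 expr0n.
Qed.

(** Multiplication by the indicator function of [A], that is, the orthogonal
   projection onto the functions supported in [A]. *)
Definition restr (A : set G) f : E := Ell2 (restr_subproof A f).

Lemma restrE A f x : restr A f x = if x \in A then f x else 0.
Proof. by []. Qed.

Lemma restr_is_linear A : linear (restr A).
Proof.
move=> a f g; apply: ell2_eq => x; rewrite ell2D ell2Z !restrE.
by case: ifP => // _; rewrite mulr0 addr0.
Qed.

HB.instance Definition _ A :=
  GRing.isLinear.Build _ _ _ _ (restr A) (restr_is_linear A).

Lemma l2norm_restr A f : N (restr A f) <= N f.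
Proof.
apply: l2norm_mono => x; rewrite restrE; case: ifP => // _.
by rewrite normc0 normc_ge0.
Qed.

Lemma l2norm_restrU (A B : set G) f : A `&` B = set0 ->
  N (restr (A `|` B) f) ^+ 2 = N (restr A f) ^+ 2 + N (restr B f) ^+ 2.
Proof.
move=> AB; apply: EFin_inj; rewrite EFinD !l2norm_sqr -esumD//.
apply: eq_esum => x _; rewrite !restrE in_setU -EFinD; congr (_%:E).
have n0 : normc (0 : R[i]) ^+ 2 = 0 by rewrite normc0 expr0n.
have [xA|xA] := boolP (x \in A); last by rewrite n0 add0r.
rewrite (_ : (x \in B) = false) ?n0 ?addr0//; apply/negP; rewrite inE => xB.
by have : set0 x by rewrite -AB; split=> //; rewrite -inE.
Qed.

End EllTwoNorm.

Arguments ell2_eq {R G f g}.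
#[local] Hint Extern 0 (is_true (@Order.le _ _ _ (l2norm _))) => exact: l2norm_ge0 : core.

(** * Bounded operators and operator-norm closures *)

Section Operators.
Variables (R : realType) (G : groupType).
Notation E := (ell2 R G).
Notation N := (@l2norm R G).
Implicit Types (f : E) (T U : E -> E) (s t x y : G).

Lemma fct_sum (I : Type) (r : seq I) (F : I -> E -> E) f :
  (\sum_(i <- r) F i) f = \sum_(i <- r) F i f.
Proof. by elim/big_ind2: _ => // a1 a2 b1 b2 <- <-. Qed.

Lemma bounded_linear T : bounded_operator T -> linear T. Proof. by case. Qed.

Lemma bounded_operator_at0 T : bounded_operator T -> T 0 = 0.
Proof.
by move=> bT; have := bounded_linear bT (-1) 0 0; rewrite scaler0 add0r scaleN1r addNr.
Qed.

Lemma bounded_operator_sub T u v : bounded_operator T -> T (u - v) = T u - T v.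
Proof.
by move=> bT; have := bounded_linear bT (-1) v u; rewrite !scaleN1r ![- _ + _]addrC.
Qed.

Lemma bounded_operator_gt0 T : bounded_operator T ->
  exists2 M : R, 0 < M & forall f, N (T f) <= M * N f.
Proof.
move=> [_ [M TM]]; exists (`|M| + 1); first by rewrite ltr_wpDl.
move=> f; apply: le_trans (TM f) _; rewrite ler_wpM2r//.
by apply: le_trans (ler_norm _) _; rewrite lerDl.
Qed.

Lemma bounded_operator0 : bounded_operator (0 : E -> E).
Proof.
split; first by move=> a f g; rewrite scaler0 addr0.
by exists 0 => f; rewrite l2norm0 mul0r.
Qed.

Lemma bounded_operator_id : bounded_operator (@id E).
Proof. by split=> //; exists 1 => f; rewrite mul1r. Qed.

Lemma bounded_operator_lambda s : bounded_operator (@lambda R G s).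
Proof.
split; first exact: lambda_is_linear.
by exists 1 => f; rewrite l2norm_lambda mul1r.
Qed.

Lemma bounded_operatorZD (a : R[i]) T U :
  bounded_operator T -> bounded_operator U -> bounded_operator (a *: T + U).
Proof.
move=> bT bU; split.
  move=> b f g; have lT := bounded_linear bT; have lU := bounded_linear bU.
  change (a *: T (b *: f + g) + U (b *: f + g) =
    b *: (a *: T f + U f) + (a *: T g + U g)).
  by rewrite lT lU !scalerDr !scalerA (mulrC a) addrACA.
have [M _ TM] := bounded_operator_gt0 bT.
have [K _ UK] := bounded_operator_gt0 bU.
exists (normc a * M + K) => f; rewrite (le_trans (ler_l2normD _ _))//.
by rewrite mulrDl lerD// l2normZ -mulrA ler_wpM2l// normc_ge0.
Qed.

Lemma bounded_operatorB T U :
  bounded_operator T -> bounded_operator U -> bounded_operator (T - U).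
Proof.
by move=> bT bU; rewrite addrC -scaleN1r; exact: bounded_operatorZD.
Qed.

Lemma bounded_operatorM T U :
  bounded_operator T -> bounded_operator U -> bounded_operator (T \o U).
Proof.
move=> bT bU; split.
  by move=> a f g /=; rewrite (bounded_linear bU) (bounded_linear bT).
have [M M0 TM] := bounded_operator_gt0 bT.
have [K _ UK] := bounded_operator_gt0 bU.
exists (M * K) => f; rewrite (le_trans (TM _))// -mulrA ler_wpM2l//.
exact: ltW.
Qed.

Lemma l2norm_bounded T : bounded_operator T ->
  forall f, N (T f) <= opnorm T * N f.
Proof.
move=> bT f; have [M M0 TM] := bounded_operator_gt0 bT.
have lT := bounded_linear bT.
have T0 := bounded_operator_at0 bT.
have TZ a g : T (a *: g) = a *: T g by have := lT a g 0; rewrite !addr0 T0 addr0.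
have [f0|f0] := eqVneq (N f) 0; first by rewrite (l2norm_eq0 f0) T0 !l2norm0 mulr0.
have fgt0 : 0 < N f by rewrite lt_neqAle eq_sym f0 l2norm_ge0.
rewrite -ler_pdivrMr//; apply: sup_ubound.
  exists M => _ [g /= g1 <-]; apply: le_trans (TM g) _.
  by rewrite ler_piMr// ltW.
have nV : normc ((N f)^-1%:C)%C = (N f)^-1.
  by rewrite normc_real ger0_norm// invr_ge0 ltW.
exists (((N f)^-1%:C)%C *: f) => /=; first by rewrite l2normZ nV mulVf.
by rewrite TZ l2normZ nV mulrC.
Qed.

Lemma opnorm_le T (M : R) : 0 <= M -> (forall f, N (T f) <= M * N f) ->
  opnorm T <= M.
Proof.
move=> M0 TM; apply: ge_sup.
  by exists (N (T 0)), 0 => //=; rewrite l2norm0.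
by move=> _ [g /= g1 <-]; rewrite (le_trans (TM g))// ler_piMr.
Qed.

(** Approximation in operator norm as an inequality between vectors, which is
   the form in which the closures below are handled. *)
Lemma opclosureP (S : set (E -> E)) T : S `<=` @bounded_operator R G ->
  opclosure S T <-> bounded_operator T /\
    forall e : R, 0 < e -> exists2 U, S U & forall f, N (T f - U f) <= e * N f.
Proof.
move=> bS; split=> [[bT h]|[bT h]]; split=> // e e0.
  have [U SU Ue] := h e e0; exists U => // f.
  have := l2norm_bounded (bounded_operatorB bT (bS _ SU)) f.
  move=> /le_trans; apply; rewrite ler_wpM2r//; exact: ltW.
have [U SU Ue] := h _ (divr_gt0 e0 (ltr0Sn _ 1)); exists U => //.
apply: (@le_lt_trans _ _ (e / 2)); last by rewrite ltr_pdivrMr// ltr_pMr// ltr1n.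
by apply: opnorm_le => //; rewrite divr_ge0// ltW.
Qed.

Lemma opclosure_bounded (S : set (E -> E)) : opclosure S `<=` @bounded_operator R G.
Proof. by move=> T []. Qed.

Lemma opclosureS (S S' : set (E -> E)) : S `<=` S' -> opclosure S `<=` opclosure S'.
Proof.
by move=> SS' T [bT h]; split=> // e /h[U SU Ue]; exists U => //; exact: SS'.
Qed.

Lemma sub_opclosure (S : set (E -> E)) : S `<=` @bounded_operator R G ->
  S `<=` opclosure S.
Proof.
move=> bS T ST; apply/(opclosureP _ bS); split; first exact: bS.
move=> e e0; exists T => // f; rewrite subrr l2norm0 mulr_ge0//; exact: ltW.
Qed.

Lemma opclosure_idem (S : set (E -> E)) : S `<=` @bounded_operator R G ->
  opclosure (opclosure S) `<=` opclosure S.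
Proof.
move=> bS T /(opclosureP _ (@opclosure_bounded S))[bT h].
apply/(opclosureP _ bS); split=> // e e0.
have e2 : 0 < e / 2 by rewrite divr_gt0.
have [U /(opclosureP _ bS)[bU h'] hU] := h _ e2.
have [V SV hV] := h' _ e2; exists V => // f.
have -> : T f - V f = (T f - U f) + (U f - V f) by rewrite addrA subrK.
by rewrite (le_trans (ler_l2normD _ _))// [e]splitr mulrDl lerD.
Qed.

Lemma opclosureZD (S : set (E -> E)) : S `<=` @bounded_operator R G ->
  (forall (a : R[i]) T U, S T -> S U -> S (a *: T + U)) ->
  forall (a : R[i]) T U, opclosure S T -> opclosure S U ->
    opclosure S (a *: T + U).
Proof.
move=> bS SD a T U /(opclosureP _ bS)[bT hT] /(opclosureP _ bS)[bU hU].
apply/(opclosureP _ bS); split=> [|e e0]; first exact: bounded_operatorZD.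
have a1 : 0 < normc a + 1 by rewrite ltr_wpDl// normc_ge0.
have [T' ST' hT'] := hT (e / (normc a + 1) / 2) (divr_gt0 (divr_gt0 e0 a1) (ltr0Sn _ 1)).
have [U' SU' hU'] := hU (e / 2) (divr_gt0 e0 (ltr0Sn _ 1)).
exists (a *: T' + U'); first exact: SD.
move=> f; change (N (a *: T f + U f - (a *: T' f + U' f)) <= e * N f).
have -> : a *: T f + U f - (a *: T' f + U' f) = a *: (T f - T' f) + (U f - U' f).
  by rewrite scalerBr opprD addrACA.
rewrite (le_trans (ler_l2normD _ _))// [X in X * _]splitr mulrDl lerD// l2normZ.
apply: (@le_trans _ _ ((normc a + 1) * N (T f - T' f))).
  by rewrite ler_wpM2r// lerDl.
rewrite -ler_pdivlMl//; apply: le_trans (hT' f) _.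
by rewrite le_eqVlt; apply/orP; left; apply/eqP; field; rewrite gt_eqF.
Qed.

(** Multiplication is jointly continuous on bounded sets. *)
Lemma opclosureM (S1 S2 S : set (E -> E)) :
  S1 `<=` @bounded_operator R G -> S2 `<=` @bounded_operator R G ->
  S `<=` @bounded_operator R G ->
  (forall T U, S1 T -> S2 U -> S (T \o U)) ->
  forall T U, opclosure S1 T -> opclosure S2 U -> opclosure S (T \o U).
Proof.
move=> b1 b2 b SM T U /(opclosureP _ b1)[bT hT] /(opclosureP _ b2)[bU hU].
apply/(opclosureP _ b); split=> [|e e0]; first exact: bounded_operatorM.
have [M M0 TM] := bounded_operator_gt0 bT.
have [U' SU' hU'] := hU (e / 2 / M) (divr_gt0 (divr_gt0 e0 (ltr0Sn _ 1)) M0).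
have [K K0 UK] := bounded_operator_gt0 (b2 _ SU').
have [T' ST' hT'] := hT (e / 2 / K) (divr_gt0 (divr_gt0 e0 (ltr0Sn _ 1)) K0).
exists (T' \o U'); first exact: SM.
move=> f /=.
have -> : T (U f) - T' (U' f) = T (U f - U' f) + (T (U' f) - T' (U' f)).
  by rewrite (bounded_operator_sub _ _ bT) addrA subrK.
rewrite (le_trans (ler_l2normD _ _))// [e]splitr mulrDl lerD//.
  rewrite (le_trans (TM _))// -ler_pdivlMl// (le_trans (hU' f))//.
  by rewrite le_eqVlt; apply/orP; left; apply/eqP; field; rewrite gt_eqF.
rewrite (le_trans (hT' _))//.
have e2K : 0 <= e / 2 / K by rewrite !divr_ge0// ltW.
rewrite (le_trans (ler_wpM2l e2K (UK f)))//.
by rewrite le_eqVlt; apply/orP; left; apply/eqP; field; rewrite gt_eqF.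
Qed.

End Operators.

(** * The reduced group algebra *)

Section ReducedAlgebra.
Variables (R : realType) (G : groupType).
Notation E := (ell2 R G).
Notation N := (@l2norm R G).
Notation A := (@reduced_Cstar_algebra R G).
Notation C0 := (@regular_group_algebra R G).
Implicit Types (f : E) (T U : E -> E) (s t x y : G) (c : seq (R[i] * G)).

(** The operator of the regular representation attached to a formal linear
   combination of group elements. *)
Definition lambda_sum c : E -> E := \sum_(p <- c) p.1 *: lambda p.2.

Lemma lambda_sumE c f : lambda_sum c f = \sum_(p <- c) p.1 *: lambda p.2 f.
Proof. by rewrite /lambda_sum fct_sum. Qed.

Lemma lambda_sum_bounded c : bounded_operator (lambda_sum c).
Proof.
rewrite /lambda_sum; elim: c => [|p c IH]; first by rewrite big_nil; exact: bounded_operator0.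
rewrite big_cons; apply: bounded_operatorZD => //; exact: bounded_operator_lambda.
Qed.

Lemma regular_bounded : C0 `<=` @bounded_operator R G.
Proof. by move=> _ [c ->]; exact: lambda_sum_bounded. Qed.

Lemma lambda_sum_regular c : C0 (lambda_sum c). Proof. by exists c. Qed.

Lemma lambda_sumZD (a : R[i]) c d :
  a *: lambda_sum c + lambda_sum d = lambda_sum ([seq (a * p.1, p.2) | p <- c] ++ d).
Proof.
rewrite /lambda_sum big_cat big_map scaler_sumr; congr (_ + _).
by apply: eq_bigr => p _; rewrite scalerA.
Qed.

Lemma lambda_sumM c d :
  lambda_sum c \o lambda_sum d =
  lambda_sum [seq (p.1 * q.1, (p.2 * q.2)%g) | p <- c, q <- d].
Proof.
apply/funext => f /=; rewrite !lambda_sumE big_allpairs_dep.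
apply: eq_bigr => p _; rewrite linear_sum scaler_sumr.
by apply: eq_bigr => q _; rewrite linearZ scalerA /= lambdaM.
Qed.

Lemma reduced_bounded : A `<=` @bounded_operator R G.
Proof. exact: opclosure_bounded. Qed.

Lemma reduced_lambda s : A (lambda s).
Proof.
apply: sub_opclosure; first exact: regular_bounded.
by exists [:: (1, s)]; rewrite big_seq1 scale1r.
Qed.

Lemma reduced_id : A id.
Proof.
rewrite (_ : id = @lambda R G 1); first exact: reduced_lambda.
by apply/funext => f; rewrite lambda1.
Qed.

Lemma reduced_approx T : A T -> forall e : R, 0 < e ->
  exists c, forall f, N (T f - lambda_sum c f) <= e * N f.
Proof.
move=> /(opclosureP _ regular_bounded)[_ h] e /h[_ [c ->] hc].
by exists c.
Qed.

Lemma sqnorm2_delta x : sqnorm2 (fun y => (y == x)%:R : R[i]) = 1%E.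
Proof.
rewrite -(esum_indicator R x); apply: eq_esum => y _.
by case: eqP => _; rewrite ?normc1 ?normc0 ?expr1n ?expr0n.
Qed.

Fact delta_subproof x : (fun y => (y == x)%:R : R[i]^o) \in @l2 R G.
Proof. by rewrite inE /= sqnorm2_delta ltry. Qed.

Definition delta x : E := Ell2 (delta_subproof x).

Lemma deltaE x y : delta x y = (y == x)%:R. Proof. by []. Qed.

Lemma l2norm_delta x : N (delta x) = 1.
Proof. by rewrite /l2norm sqnorm2_delta /= sqrtr1. Qed.

Lemma lambda_delta s x : lambda s (delta x) = delta (s * x).
Proof.
apply: ell2_eq => y; rewrite lambdaE !deltaE.
by rewrite -(inj_eq (mulgI s)) mulVKg.
Qed.

Lemma lambda_sum_delta1 c :
  lambda_sum c (delta 1) 1%g = \sum_(p <- c | p.2 == 1%g) p.1.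
Proof.
rewrite lambda_sumE ell2_sum [RHS]big_mkcond; apply: eq_bigr => p _.
rewrite ell2Z lambda_delta deltaE mulg1 eq_sym.
by case: eqP; rewrite ?mulr1 ?mulr0.
Qed.

Fact rtrans_subproof y f : (fun x => f (x * y)%g : R[i]^o) \in @l2 R G.
Proof.
rewrite inE /= (le_lt_trans _ (sqnorm2_lty f))// /sqnorm2.
rewrite [leRHS](@reindex_esum _ _ _ [set: G] [set: G] (fun x => (x * y)%g))//.
split=> //; first by move=> a b _ _ /mulIg.
by move=> x _; exists (x * y^-1)%g => //; rewrite mulgVK.
Qed.

(** The right regular representation, whose operators commute with those of
   the reduced algebra. *)
Definition rtrans y f : E := Ell2 (rtrans_subproof y f).

Lemma rtransE y f x : rtrans y f x = f (x * y)%g. Proof. by []. Qed.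

Lemma l2norm_rtrans y f : N (rtrans y f) = N f.
Proof.
congr (Num.sqrt (fine _)); rewrite /sqnorm2.
rewrite [RHS](@reindex_esum _ _ _ [set: G] [set: G] (fun x => (x * y)%g))//.
split=> //; first by move=> a b _ _ /mulIg.
by move=> x _; exists (x * y^-1)%g => //; rewrite mulgVK.
Qed.

Lemma rtrans_lambda_sum c y f : lambda_sum c (rtrans y f) = rtrans y (lambda_sum c f).
Proof.
apply: ell2_eq => x; rewrite rtransE !lambda_sumE !ell2_sum.
by apply: eq_bigr => p _; rewrite !ell2Z !lambdaE rtransE mulgA.
Qed.

Lemma reduced_rtrans T y f : A T -> T (rtrans y f) = rtrans y (T f).
Proof.
move=> AT; apply/eqP; rewrite -subr_eq0; apply/eqP/l2norm_eq0/eqP.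
rewrite eq_le l2norm_ge0 andbT; apply/ler_addgt0Pr => e e0; rewrite add0r.
have d0 : 0 < e / (2 * (N f + 1)) by rewrite divr_gt0// mulr_gt0// ltr_wpDl.
have [c hc] := reduced_approx AT d0.
have -> : T (rtrans y f) - rtrans y (T f) = (T (rtrans y f) - lambda_sum c (rtrans y f))
   - rtrans y (T f - lambda_sum c f).
  rewrite rtrans_lambda_sum; apply: ell2_eq => x.
  by rewrite !ell2B !rtransE ell2B; ring.
rewrite (le_trans (ler_l2normD _ _))// l2normN l2norm_rtrans.
rewrite (le_trans (lerD (hc _) (hc _)))// l2norm_rtrans.
have f1 : 0 < N f + 1 by rewrite ltr_wpDl.
rewrite -[leRHS]mulr1 -mulrDr -mulrA ler_wpM2l ?(ltW e0)//.
rewrite ler_pdivrMl ?mulr_gt0// mulr1 mulrDr mulr1 mulr_natl mulr2n.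
by rewrite lerDl.
Qed.

End ReducedAlgebra.

(** * Averaging over conjugates forces simplicity *)

Section Averaging.
Variables (R : realType) (G : groupType).
Notation E := (ell2 R G).
Notation N := (@l2norm R G).
Notation A := (@reduced_Cstar_algebra R G).
Implicit Types (f : E) (S T U : E -> E) (s t x y : G) (c : seq (R[i] * G)).

(** A finite set carrying almost all of the mass of [f] leaves a remainder of
   small norm, by Pythagoras. *)
Lemma finite_approx f (e : R) : 0 < e -> exists r : seq G,
  N (f - \sum_(x <- r) f x *: delta R x) ^+ 2 <= e.
Proof.
move=> e0; have fin : sqnorm2 f \is a fin_num.
  by rewrite ge0_fin_numE ?sqnorm2_ge0// sqnorm2_lty.
have [_ [F [finF _] <-] hF] := ub_ereal_sup_adherent e0 fin.
exists (finmap.enum_fset (fset_set F)).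
have finE : restr F f = \sum_(x <- finmap.enum_fset (fset_set F)) f x *: delta R x.
  apply: ell2_eq => x; rewrite ell2_sum restrE.
  under eq_bigr do rewrite ell2Z deltaE eq_sym.
  have [xF|xF] := boolP (x \in F).
    rewrite (bigD1_seq x) ?finmap.fset_uniq ?in_fset_set//= eqxx mulr1 big1 ?addr0//.
    by move=> y yx; rewrite (negPf yx) mulr0.
  rewrite big_seq big1// => y; rewrite in_fset_set// => yF.
  by case: eqP yF xF => [->->//|]; rewrite mulr0.
rewrite -finE.
have dec : f - restr F f = restr (~` F) f.
  apply: ell2_eq => x; rewrite ell2B !restrE in_setC.
  by case: (x \in F); rewrite ?subrr ?subr0.
have pyth := l2norm_restrU f (setICr F); rewrite setUv in pyth.
have fT : restr [set: G] f = f by apply: ell2_eq => x; rewrite restrE in_setT.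
have sF : (N (restr F f) ^+ 2)%:E = (\sum_(x \in F) (normc (f x) ^+ 2)%:E)%E.
  rewrite l2norm_sqr -esum_fset//; last by move=> x _; rewrite lee_fin sqr_ge0.
  rewrite [RHS]esum_mkcond; apply: eq_esum => x _; rewrite restrE.
  by case: ifP => // _; rewrite normc0 expr0n.
have : (sqnorm2 f - e%:E < \sum_(x \in F) (normc (f x) ^+ 2)%:E)%E by [].
rewrite -sF -l2norm_sqr -EFinB lte_fin.
by rewrite dec -[in X in X - e]fT pyth ltrBlDr ltrD2l => /ltW.
Qed.

(** Finitely supported vectors are dense. *)
Lemma bounded_eq0 T : bounded_operator T -> (forall x, T (delta R x) = 0) ->
  T = 0.
Proof.
move=> bT T0; apply/funext => f; apply: l2norm_eq0; apply/eqP.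
have Tz := bounded_operator_at0 bT.
have Ts (r : seq G) : T (\sum_(x <- r) f x *: delta R x) = 0.
  by elim: r => [|x r IH]; rewrite ?big_nil// big_cons (bounded_linear bT) IH T0 scaler0 addr0.
have [M M0 TM] := bounded_operator_gt0 bT.
rewrite -sqrf_eq0 eq_le sqr_ge0 andbT; apply/ler_addgt0Pr => e e0; rewrite add0r.
have [r hr] := finite_approx f (divr_gt0 e0 (exprn_gt0 2 M0)).
set g := \sum_(x <- r) _ in hr.
have -> : T f = T (f - g) by rewrite (bounded_operator_sub _ _ bT) Ts subr0.
apply: (@le_trans _ _ ((M * N (f - g)) ^+ 2)).
  by rewrite ler_pXn2r ?nnegrE// mulr_ge0// ltW.
by rewrite exprMn mulrC -ler_pdivlMr// exprn_gt0.
Qed.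

Definition averaged (gs : seq G) (e : R) t := forall f,
  N (\sum_(g <- gs) lambda (g * t * g^-1) f) <= e * (size gs)%:R * N f.

(** Powers' averaging property.  One average serves all of [F], so that it
   applies to linear combinations of the elements of [F]. *)
Definition averaging_property := forall (F : seq G) (e : R), 0 < e ->
  (forall t, t \in F -> t != 1%g) ->
  exists2 gs : seq G, (0 < size gs)%N & forall t, t \in F -> averaged gs e t.

(** The canonical trace of [T] is the coefficient [T (delta 1) 1].  An operator
   of the reduced algebra is determined by its value at [delta 1], since it
   commutes with right translations; a left translation moves a nonzero
   coefficient of that value to [1]. *)
Lemma ideal_trace_neq0 (I : set (E -> E)) S : closed_two_sided_ideal A I ->
  I S -> S <> 0 -> exists2 U, I U & U (delta R 1%g) 1%g != 0.
Proof.
move=> [IA _ IM _] IS S0; have AS := IA _ IS.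
have [x Sx] : exists x, S (delta R x) <> 0.
  apply: contrapT => /forallNP h; apply: S0; apply: bounded_eq0.
    exact: reduced_bounded AS.
  by move=> x; apply: contrapT (h x).
have Sdx : S (delta R x) = rtrans x^-1 (S (delta R 1%g)).
  rewrite -reduced_rtrans//; congr S; apply: ell2_eq => y.
  by rewrite rtransE !deltaE -(inj_eq (mulIg (x^-1)%g)) mulgV.
have [s hs] : exists s, S (delta R 1%g) s != 0.
  apply: contrapT => /forallNP h; apply: Sx; apply: ell2_eq => y.
  by rewrite Sdx rtransE; apply/eqP; apply: contrapT => /negP; apply: h.
exists (lambda s^-1 \o S); first by have [] := IM _ _ (reduced_lambda R s^-1) IS.
by rewrite /= invgK mulg1.
Qed.

(** Averaging [S] over conjugates stays in the ideal and fixes the trace, while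
   the other coefficients of a finite approximation of [S] are averaged away. *)
Lemma averaging_trace_in_ideal (I : set (E -> E)) S : averaging_property ->
  closed_two_sided_ideal A I -> I S ->
  I (S (delta R 1%g) 1%g *: @id E).
Proof.
move=> avg [IA [I0 IZD] IM Icl] IS.
have bI : I `<=` @bounded_operator R G by move=> T /IA; exact: reduced_bounded.
apply: Icl; apply/(opclosureP _ bI); split.
  have := bounded_operatorZD (S (delta R 1%g) 1%g) (bounded_operator_id R G)
    (bounded_operator0 R G).
  by rewrite addr0.
move=> e e0; set a := S (delta R 1%g) 1%g.
have e3 : 0 < e / 3 by rewrite divr_gt0.
have [c hc] := reduced_approx (IA _ IS) e3.
pose K : R := \sum_(p <- c) normc p.1 + 1.
have K0' : 0 <= \sum_(p <- c) normc p.1 by apply: sumr_ge0 => p _; exact: normc_ge0.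
have K0 : 0 < K by rewrite ltr_wpDl.
have [gs gs0 hgs] := avg [seq p.2 | p <- c & p.2 != 1%g] _ (divr_gt0 e3 K0)
  (fun t => ltac:(by move=> /mapP[p]; rewrite mem_filter => /andP[? _] ->)).
pose n : R := (size gs)%:R.
have n0 : 0 < n by rewrite ltr0n.
pose cj g := lambda g \o S \o lambda g^-1.
have Icj g : I (cj g).
  have [_ h] := IM _ _ (reduced_lambda R g^-1) IS.
  by have [] := IM _ _ (reduced_lambda R g) h.
have Isum : I (\sum_(g <- gs) cj g).
  elim: (gs) => [|g r IH]; first by rewrite big_nil.
  by rewrite big_cons -[cj g]scale1r; exact: IZD.
(* Three errors of size [e / 3]: the averaged approximation error of [S], the
   averaged nontrivial coefficients, and the error made on the trace. *)
exists ((n^-1)%:C%C *: \sum_(g <- gs) cj g).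
  by rewrite -[_ *: _]addr0; exact: IZD.
move=> f.
change (N (a *: f - (n^-1)%:C%C *: (\sum_(g <- gs) cj g) f) <= e * N f).
rewrite fct_sum.
set b := \sum_(p <- c | p.2 == 1%g) p.1.
have ab : normc (a - b) <= e / 3.
  rewrite /a /b -lambda_sum_delta1 -ell2B.
  apply: le_trans (normc_le_l2norm _ _) _.
  by apply: le_trans (hc _) _; rewrite l2norm_delta mulr1.
pose rest := \sum_(p <- c | p.2 != 1%g) p.1 *:
  \sum_(g <- gs) lambda (g * p.2 * g^-1) f.
have cjc : \sum_(g <- gs) lambda g (lambda_sum c (lambda g^-1 f))
    = n%:C%C *: (b *: f) + rest.
  have -> : n%:C%C *: (b *: f) = \sum_(p <- c | p.2 == 1%g) p.1 *:
      \sum_(g <- gs) lambda (g * p.2 * g^-1) f.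
    rewrite scalerA mulrC -scalerA scaler_suml.
    apply: eq_bigr => p /eqP->; congr (_ *: _).
    under eq_bigr do rewrite mulg1 mulgV lambda1.
    by rewrite big_const_seq count_predT iter_addr_0 -scaler_nat rmorph_nat.
  under eq_bigr do rewrite lambda_sumE linear_sum.
  rewrite exchange_big (bigID (fun p => p.2 == 1%g))/= /rest.
  by congr (_ + _); apply: eq_bigr => p _; rewrite scaler_sumr;
    apply: eq_bigr => g _; rewrite linearZ /= -!lambdaM.
have restN : N rest <= e / 3 * n * N f.
  rewrite /rest -big_filter; apply: le_trans (ler_l2norm_sum _ _) _.
  apply: (@le_trans _ _ (\sum_(p <- c) normc p.1 * (e / 3 / K * n * N f))).
    rewrite big_filter big_mkcond big_seq [leRHS]big_seq; apply: ler_sum => p pc.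
    have B0 : 0 <= e / 3 / K * n * N f.
      by rewrite !mulr_ge0 ?invr_ge0//; exact: ltW.
    case: ifP => p1; last by rewrite mulr_ge0 ?normc_ge0.
    rewrite l2normZ ler_wpM2l ?normc_ge0//.
    by apply: hgs; apply/mapP; exists p; rewrite ?mem_filter ?p1.
  rewrite -mulr_suml.
  have -> : e / 3 * n * N f = K * (e / 3 / K * n * N f).
    by field; rewrite gt_eqF.
  rewrite ler_wpM2r ?lerDl//.
  by rewrite !mulr_ge0// ?invr_ge0; exact: ltW.
have difN : N (\sum_(g <- gs) cj g f - \sum_(g <- gs) lambda g (lambda_sum c (lambda g^-1 f)))
    <= e / 3 * n * N f.
  rewrite -sumrB; apply: le_trans (ler_l2norm_sum _ _) _.
  apply: (@le_trans _ _ (\sum_(g <- gs) e / 3 * N f)).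
    apply: ler_sum => g _; rewrite /cj /= -linearB l2norm_lambda.
    by rewrite (le_trans (hc _))// l2norm_lambda.
  rewrite big_const_seq count_predT iter_addr_0 -[leLHS]mulr_natr -/n.
  by rewrite -[leRHS]mulrA [n * _]mulrC mulrA.
set Q := \sum_(g <- gs) cj g f in difN *.
set Q' := \sum_(g <- gs) lambda g (lambda_sum c (lambda g^-1 f)) in difN cjc.
have nV : n%:C%C != 0 :> R[i].
  by apply/eqP => /(congr1 (@complex.Re R))/= n0'; rewrite n0' ltxx in n0.
have -> : a *: f - (n^-1)%:C%C *: Q =
    (a - b) *: f - (n^-1)%:C%C *: (Q - Q') - (n^-1)%:C%C *: rest.
  have -> : rest = Q' - n%:C%C *: (b *: f) by rewrite cjc addrAC subrr add0r.
  have nVE : (n^-1)%:C%C = (n%:C%C)^-1 := fmorphV (real_complex R) n.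
  apply: ell2_eq => x; rewrite !(ell2B, ell2Z) nVE; move: (n%:C%C) nV => m m0; field; exact: m0.
have ninv g : N ((n^-1)%:C%C *: g) = n^-1 * N g.
  by rewrite l2normZ normc_real ger0_norm// invr_ge0 ltW.
have bnd g : N g <= e / 3 * n * N f -> N ((n^-1)%:C%C *: g) <= e / 3 * N f.
  by rewrite ninv => h; rewrite ler_pdivrMl// mulrA [n * _]mulrC.
apply: le_trans (ler_l2normD _ _) _; rewrite l2normN.
apply: (@le_trans _ _ (e / 3 * N f + e / 3 * N f + e / 3 * N f)).
  apply: lerD; last exact: bnd.
  apply: le_trans (ler_l2normD _ _) _; rewrite l2normN.
  apply: lerD; last exact: bnd.
  by rewrite l2normZ ler_wpM2r.
by rewrite le_eqVlt; apply/orP; left; apply/eqP; field.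
Qed.

Lemma averaging_Cstar_simple : averaging_property -> Cstar_simple R G.
Proof.
move=> avg; split.
  move=> A0; have := reduced_id R G; rewrite A0 => /(congr1 (fun T => N (T (delta R 1%g)))).
  by rewrite /= l2norm_delta l2norm0 => /eqP; rewrite oner_eq0.
move=> I idI; have [IA [I0 IZD] IM Icl] := idI.
have [I0E|/existsNP[S /not_implyP[IS S0]]] := pselect (forall S, I S -> S = 0).
  by left; apply/seteqP; split=> [S /I0E//|_ ->].
right; apply/seteqP; split=> // T AT.
have [U IU U0] := ideal_trace_neq0 idI IS S0.
have := IZD (U (delta R 1%g) 1%g)^-1 _ _ (averaging_trace_in_ideal avg idI IU) I0.
rewrite addr0 scalerA mulVf// scale1r => Iid.
by have [] := IM _ _ AT Iid.
Qed.

End Averaging.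

(** * Contractions coming from non-amenability *)

Section SumOfSquares.
Variable R : realDomainType.

Lemma sqr_sum_le (n : nat) (b : nat -> R) :
  (\sum_(i < n) b i) ^+ 2 <= n%:R * \sum_(i < n) b i ^+ 2.
Proof.
elim: n => [|n IH]; first by rewrite !big_ord0 expr0n mulr0.
rewrite !big_ord_recr/=; set S := \sum_(i < n) b i in IH *.
set Q := \sum_(i < n) b i ^+ 2 in IH *; set x := b n.
have Q0 : 0 <= Q by apply: sumr_ge0 => i _; exact: sqr_ge0.
have [n0|n0] := posnP n; first by rewrite /S /Q n0 !big_ord0 !add0r mul1r.
rewrite -natr1; set m : R := n%:R in IH *; have m0 : 0 < m by rewrite ltr0n.
have h : 0 <= (S - m * x) ^+ 2 by exact: sqr_ge0.
rewrite -subr_ge0 -(pmulr_rge0 _ m0).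
have -> : m * ((m + 1) * (Q + x ^+ 2) - (S + x) ^+ 2) =
  (m + 1) * (m * Q - S ^+ 2) + (S - m * x) ^+ 2 by ring.
by rewrite addr_ge0// mulr_ge0 ?subr_ge0// addr_ge0// ltW.
Qed.

End SumOfSquares.

Section AlmostInvariance.
Variables (R : realType) (G : groupType).
Notation E := (ell2 R G).
Notation N := (@l2norm R G).
Implicit Types (f : E) (H K : set G) (s t x y : G) (gs : seq G).

Definition is_subgroup H :=
  [/\ H 1%g, forall x y, H x -> H y -> H (x * y)%g & forall x, H x -> H (x^-1)%g].

(** The restriction to [H] of the regular representation of [G] weakly contains
   the trivial representation.  That restriction is a multiple of the regular
   representation of [H], so this is amenability of [H], in a form which is
   visibly stable under subgroups, conjugation and directed unions. *)
Definition almost_invariant H := forall (S : seq G) (e : R), 0 < e ->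
  (forall s, s \in S -> H s) ->
  exists f : E, N f = 1 /\ forall s, s \in S -> N (lambda s f - f) <= e.

Lemma almost_invariant_conj H K (k : G) : (forall h, H h -> K (k * h * k^-1)%g) ->
  almost_invariant K -> almost_invariant H.
Proof.
move=> HK aK S e e0 SH; pose S' := [seq (k * s * k^-1)%g | s <- S].
have [|f [f1 hf]] := aK S' e e0; first by move=> _ /mapP[s /SH/HK h ->].
exists (lambda k^-1 f); rewrite l2norm_lambda; split=> // s sS.
have -> : lambda s (lambda k^-1 f) = lambda k^-1 (lambda (k * s * k^-1) f).
  by rewrite -!lambdaM !mulgA mulVg mul1g.
by rewrite -linearB l2norm_lambda; apply: hf; apply/mapP; exists s.
Qed.

(** If no unit vector is almost fixed by [S], then by the parallelogram law
   averaging over [S] together with the identity shortens every vector by a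
   definite factor; powers of this average shorten arbitrarily well. *)
Lemma not_almost_invariant_contracting H : is_subgroup H -> ~ almost_invariant H ->
  forall d : R, 0 < d -> exists gs, [/\ (0 < size gs)%N, forall g, g \in gs -> H g
    & forall f, N (\sum_(g <- gs) lambda g f) <= d * (size gs)%:R * N f].
Proof.
move=> [H1 HM _] /existsNP[S /existsNP[e /not_implyP[e0 /not_implyP[SH /forallNP hS]]]].
have mov f : N f != 0 -> exists2 s, s \in S & e * N f <= N (lambda s f - f).
  move=> f0; have fgt0 : 0 < N f by rewrite lt_neqAle eq_sym f0 l2norm_ge0.
  have nV : normc ((N f)^-1%:C)%C = (N f)^-1.
    by rewrite normc_real ger0_norm// invr_ge0 ltW.
  apply: contrapT => h; apply: (hS (((N f)^-1%:C)%C *: f)); split.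
    by rewrite l2normZ nV mulVf.
  move=> s sS; rewrite linearZ /= -scalerBr l2normZ nV ler_pdivrMl//.
  by rewrite leNgt; apply/negP => /ltW; rewrite mulrC => hs; apply: h; exists s.
pose gs0 := 1%g :: S; pose n : R := (size gs0)%:R.
have n0 : 0 < n by rewrite ltr0n.
(* Every [f] is moved by at least [e * N f] by some [s] in [S], and then
   [N (f + lambda s f) <= (2 - e ^+ 2 / 4) * N f]; the other [n - 2] terms of
   the sum over [gs0] have norm [N f]. *)
pose c := 1 - e ^+ 2 / 4 / n.
have [c1 cbnd] : c < 1 /\ (0 <= c /\
    forall f, N (\sum_(g <- gs0) lambda g f) <= c * n * N f).
  have e20 : 0 < e ^+ 2 / 4 by rewrite divr_gt0// exprn_gt0.
  split; first by rewrite /c gtrBl divr_gt0.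
  have key f s : s \in S -> N f != 0 -> e * N f <= N (lambda s f - f) ->
      0 <= 2 - e ^+ 2 / 4 /\ N (f + lambda s f) <= (2 - e ^+ 2 / 4) * N f.
    move=> sS f0 hs; have fgt0 : 0 < N f by rewrite lt_neqAle eq_sym f0 l2norm_ge0.
    have := l2_parallelogram (lambda s f) f; rewrite l2norm_lambda [lambda s f + f]addrC.
    set A := N (f + _); set B := N (_ - f) in hs *; set F := N f in f0 hs fgt0 *.
    move=> AB; have eF : (e * F) ^+ 2 <= B ^+ 2.
      by rewrite ler_pXn2r// nnegrE ?l2norm_ge0// mulr_ge0// ltW.
    have A0 : 0 <= A ^+ 2 by exact: sqr_ge0.
    have e4 : e ^+ 2 * F ^+ 2 <= 4 * F ^+ 2 by rewrite -exprMn; lra.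
    have e4' : e ^+ 2 <= 4 by rewrite -(ler_pM2r (exprn_gt0 2 fgt0)).
    have c0 : 0 <= 2 - e ^+ 2 / 4 by lra.
    split=> //; have F0 := ltW fgt0.
    rewrite -(@ler_pXn2r _ 2)// ?nnegrE ?l2norm_ge0 ?mulr_ge0//.
    have -> : ((2 - e ^+ 2 / 4) * F) ^+ 2 =
      4 * F ^+ 2 - (e * F) ^+ 2 + (e ^+ 2 / 4) ^+ 2 * F ^+ 2 by field.
    have : 0 <= (e ^+ 2 / 4) ^+ 2 * F ^+ 2 by rewrite mulr_ge0// sqr_ge0.
    lra.
  have c0 : 0 <= c.
    have d1 : N (delta R (1%g : G)) != 0 by rewrite l2norm_delta oner_eq0.
    have [s sS hs] := mov _ d1; have [h _] := key _ _ sS d1 hs.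
    rewrite subr_ge0 ler_pdivrMr// mul1r.
    have : 2 <= n by rewrite ler_nat ltnS; case: (S) sS.
    lra.
  split=> // f; have [f0|f0] := eqVneq (N f) 0.
    rewrite (l2norm_eq0 f0) l2norm0 mulr0.
    by rewrite big1 ?l2norm0// => g _; rewrite linear0.
  have [s sS hs] := mov _ f0; have [h0 h] := key _ _ sS f0 hs.
  rewrite big_cons lambda1 (big_rem s)//= addrA.
  apply: le_trans (ler_l2normD _ _) _.
  have -> : c * n * N f = (2 - e ^+ 2 / 4) * N f + (n - 2) * N f.
    by rewrite /c; field; rewrite gt_eqF.
  apply: lerD => //; apply: le_trans (ler_l2norm_sum _ _) _.
  under eq_bigr do rewrite l2norm_lambda.
  rewrite big_const_seq count_predT iter_addr_0 size_rem// -[leLHS]mulr_natl.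
  rewrite ler_wpM2r// /n /=; case: (S) sS => //= a r _.
  by rewrite -!natr1; lra.
move: cbnd => [c0 cbnd].
have pow (k : nat) : exists gs, [/\ (0 < size gs)%N, forall g, g \in gs -> H g
    & forall f, N (\sum_(g <- gs) lambda g f) <= c ^+ k * (size gs)%:R * N f].
  elim: k => [|k [gs [gs1 gsH hgs]]].
    exists [:: 1%g]; split=> // [g|f]; first by rewrite inE => /eqP->.
    by rewrite big_seq1 lambda1 expr0 !mul1r.
  exists [seq (x * y)%g | x <- gs0, y <- gs]; rewrite size_allpairs; split=> //.
  - by rewrite muln_gt0 gs1.
  - move=> g /allpairsP[[x y] /= [xg yg ->]]; apply: HM; last exact: gsH.
    by move: xg; rewrite inE => /orP[/eqP->|/SH].
  - move=> f; rewrite big_allpairs_dep.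
    have -> : \sum_(x <- gs0) \sum_(y <- gs) lambda (x * y) f =
        \sum_(x <- gs0) lambda x (\sum_(y <- gs) lambda y f).
      by apply: eq_bigr => x _; rewrite linear_sum; apply: eq_bigr => y _; rewrite lambdaM.
    apply: le_trans (cbnd _) _.
    have -> : c ^+ k.+1 * (size gs0 * size gs)%:R * N f =
        c * n * (c ^+ k * (size gs)%:R * N f).
      by rewrite natrM exprS -/n; ring.
    by rewrite ler_wpM2l// mulr_ge0// ltW.
move=> d d0; have c1' : `|c| < 1 by rewrite ger0_norm.
have /cvgrPdist_lt/(_ d d0)[k _ /(_ k (leqnn k))/= ck] := cvg_expr c1'.
have [gs [gs1 gsH hgs]] := pow k; exists gs; split=> // f.
apply: le_trans (hgs f) _; rewrite -!mulrA ler_wpM2r//.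
  by rewrite mulr_ge0.
by move: ck; rewrite sub0r normrN ger0_norm ?exprn_ge0// => /ltW.
Qed.

(** Translate back by a chosen representative of the coset [K x]. *)
Lemma subgroup_retraction K : is_subgroup K -> exists pi : G -> G,
  (forall x, K (pi x)) /\ forall k x, K k -> pi (k * x)%g = (k * pi x)%g.
Proof.
move=> [K1 KM KV]; pose rep x := xget 1%g [set y | K (y * x^-1)%g].
have repK x : K (rep x * x^-1)%g.
  by apply: (@xgetPex _ 1%g [set y | K (y * x^-1)%g]); exists x => /=; rewrite mulgV.
exists (fun x => x * (rep x)^-1)%g; split=> [x|k x Kk].
  by have := KV _ (repK x); rewrite invgM invgK.
rewrite -mulgA; congr (_ * (_ * _^-1))%g; rewrite /rep; congr xget.
apply/seteqP; split=> y /=; rewrite invgM mulgA => Ky.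
  by have := KM _ _ Ky Kk; rewrite mulgVK.
exact: KM _ _ Ky (KV _ Kk).
Qed.

Section CommutingSubgroups.
Variables A B : set G.
Hypotheses (sA : is_subgroup A) (sB : is_subgroup B).
Hypothesis AB_comm : forall a b, A a -> B b -> (a * b = b * a)%g.
Hypothesis AB1 : forall a, A a -> B a -> a = 1%g.

Lemma commuting_product_subgroup :
  is_subgroup [set k | exists a b, [/\ A a, B b & k = (a * b)%g]].
Proof.
have [A1 AM AV] := sA; have [B1 BM BV] := sB; split.
- by exists 1%g, 1%g; rewrite mulg1.
- move=> _ _ [a [b [Aa Bb ->]]] [a' [b' [Aa' Bb' ->]]].
  exists (a * a')%g, (b * b')%g; split; [exact: AM|exact: BM|].
  by rewrite !mulgA -(mulgA a b) -(AB_comm Aa' Bb) !mulgA.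
- move=> _ [a [b [Aa Bb ->]]]; exists (a^-1)%g, (b^-1)%g; split.
  + exact: AV.
  + exact: BV.
  + by rewrite invgM -(AB_comm (AV _ Aa) (BV _ Bb)).
Qed.

(** As [A] and [B] generate their direct product, the points which a retraction
   onto this product sends into [A] form an [A]-invariant transversal of the
   [B]-cosets. *)
Lemma commuting_transversal : exists Y : set G,
  [/\ forall a y, A a -> Y y -> Y (a * y)%g,
      forall x, exists b y, [/\ B b, Y y & x = (b * y)%g]
    & forall b b' y y', B b -> B b' -> Y y -> Y y' ->
        (b * y = b' * y')%g -> b = b' /\ y = y'].
Proof.
have [A1 AM AV] := sA; have [B1 BM BV] := sB.
have [pi [piK piM]] := subgroup_retraction commuting_product_subgroup.
have KA a : A a -> exists a0 b0, [/\ A a0, B b0 & a = (a0 * b0)%g].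
  by move=> Aa; exists a, 1%g; rewrite mulg1.
have KB b : B b -> exists a0 b0, [/\ A a0, B b0 & b = (a0 * b0)%g].
  by move=> Bb; exists 1%g, b; rewrite mul1g.
exists [set y | A (pi y)]; split=> /=.
- by move=> a y Aa Ay; rewrite piM; [exact: AM|exact: KA].
- move=> x; have [a [b [Aa Bb pix]]] := piK x.
  exists b, (b^-1 * x)%g; rewrite mulVKg; split=> //.
  rewrite piM; last exact/KB/BV.
  by rewrite pix (AB_comm Aa Bb) mulKg.
- move=> b b' y y' Bb Bb' Ay Ay' e.
  have := congr1 pi e; rewrite !piM; try exact: KB.
  move=> e'.
  have e2 : (b'^-1 * b = pi y' * (pi y)^-1)%g.
    by rewrite -[in LHS](mulgK (pi y) b) e' !mulgA mulVg mul1g.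
  have bb : (b'^-1 * b)%g = 1%g.
    apply: AB1; last exact: BM (BV _ Bb') Bb.
    by rewrite e2; exact: AM Ay' (AV _ Ay).
  have {bb}bb : b = b' by rewrite -[b](mulVKg b') bb mulg1.
  by split=> //; move: e; rewrite bb => /mulgI.
Qed.

(** Multiplying each [a] by an element commuting with [A] does not spoil a
   contraction by positive combinations of elements of [A]: replace a vector by
   its norms along the cosets [B y], on which the extra factors disappear. *)
Lemma commuting_contraction gs (bf : G -> G) (M : R) :
  (forall g, g \in gs -> A g /\ B (bf g)) ->
  (forall f, N (\sum_(g <- gs) lambda g f) <= M * N f) ->
  forall f, N (\sum_(g <- gs) lambda (g * bf g) f) <= M * N f.
Proof.
move=> gsAB hgs f; have [A1 AM AV] := sA; have [B1 BM BV] := sB.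
have [Y [YA YB Yinj]] := commuting_transversal.
pose F h y : R[i]^o := if y \in Y then ((N (restr B (rtrans y h)))%:C)%C else 0.
have FN h : sqnorm2 (F h) = sqnorm2 h.
  rewrite {1}/sqnorm2; under eq_esum => y _.
    rewrite (_ : _%:E = if y \in Y then
      (\esum_(b in B) (normc (h (b * y)%g) ^+ 2)%:E)%E else 0%E); last first.
      rewrite /F; case: ifP => _; last by rewrite normc0 expr0n.
      rewrite normc_real real_normK ?num_real// l2norm_sqr.
      rewrite [RHS]esum_mkcond; apply: eq_esum => b _; rewrite restrE rtransE.
      by case: ifP => // _; rewrite normc0 expr0n.
    over.
  rewrite -esum_mkcond esum_esum; last by move=> *; rewrite lee_fin sqr_ge0.
  rewrite /sqnorm2 (@reindex_esum _ _ _ (Y `*`` (fun=> B)) [set: G]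
    (fun k => (k.2 * k.1)%g))//.
  split=> //.
  - move=> [y b] [y' b']; rewrite !inE => -[/= Yy Bb] [/= Yy' Bb'] e.
    by have [-> ->] := Yinj _ _ _ _ Bb Bb' Yy Yy' e.
  - by move=> x _; have [b [y [Bb Yy ->]]] := YB x; exists (y, b).
have F2 h : F h \in @l2 R G by rewrite inE /= FN sqnorm2_lty.
pose Fh h : E := Ell2 (F2 h).
have FhN h : N (Fh h) = N h by rewrite /l2norm FN.
rewrite -FhN -[in leRHS]FhN; apply: le_trans (hgs _).
apply: l2norm_mono => y; rewrite ell2_sum.
have -> : \sum_(g <- gs) lambda g (Fh f) y = \sum_(g <- gs) F f (g^-1 * y)%g by [].
have [yY|yY] := boolP (y \in Y); last first.
  rewrite [Fh _ y](_ : _ = 0) ?normc0 ?normc_ge0//.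
  by rewrite /Fh/= /F (negPf yY).
have gY g : g \in gs -> (g^-1 * y)%g \in Y.
  by move=> /gsAB[Ag _]; rewrite inE; apply: YA; [exact: AV|rewrite -inE].
have -> : \sum_(g <- gs) F f (g^-1 * y)%g =
    ((\sum_(g <- gs) N (restr B (rtrans (g^-1 * y)%g f)))%:C)%C.
  rewrite rmorph_sum big_seq [RHS]big_seq; apply: eq_bigr => g gg.
  by rewrite /F gY.
rewrite normc_real ger0_norm ?sumr_ge0//.
rewrite [Fh _ y](_ : _ = ((N (restr B (rtrans y (\sum_(g <- gs) lambda (g * bf g) f))))%:C)%C);
  last by rewrite /Fh/= /F yY.
rewrite normc_real ger0_norm//.
have -> : restr B (rtrans y (\sum_(g <- gs) lambda (g * bf g) f)) =
    \sum_(g <- gs) lambda (bf g) (restr B (rtrans (g^-1 * y)%g f)).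
  apply: ell2_eq => x; rewrite restrE rtransE !ell2_sum.
  have [xB|xB] := boolP (x \in B).
    rewrite big_seq [RHS]big_seq; apply: eq_bigr => g /gsAB[Ag Bg].
    have bx : B ((bf g)^-1 * x)%g by apply: BM; [exact: BV|rewrite -inE].
    rewrite !lambdaE restrE rtransE mem_set//; congr (f _).
    rewrite invgM !mulgA; congr (_ * y)%g.
    by rewrite -!mulgA; congr (_ * _)%g; apply: AB_comm; [exact: AV|rewrite -inE].
  rewrite big_seq big1// => g /gsAB[Ag Bg].
  rewrite lambdaE restrE ifF//; apply/negP; rewrite inE => bx.
  by move/negP: xB; apply; rewrite inE -[x](mulVKg (bf g)); exact: BM.
apply: le_trans (ler_l2norm_sum _ _) _.
by apply: ler_sum => g _; rewrite l2norm_lambda.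
Qed.

End CommutingSubgroups.
End AlmostInvariance.

(** * Powers' estimate *)

Section Powers.
Variables (R : realType) (G : groupType).
Notation E := (ell2 R G).
Notation N := (@l2norm R G).
Implicit Types (f : E) (t x y : G).

Lemma l2_pythagoras (u v : E) : (forall x, u x = 0 \/ v x = 0) ->
  N (u + v) ^+ 2 = N u ^+ 2 + N v ^+ 2.
Proof.
move=> uv; apply: EFin_inj; rewrite EFinD !l2norm_sqr -esumD; last 2 first.
- by move=> x _; rewrite lee_fin sqr_ge0.
- by move=> x _; rewrite lee_fin sqr_ge0.
apply: eq_esum => x _; rewrite -EFinD ell2D; congr (_%:E).
by have [->|->] := uv x; rewrite normc0 expr0n ?add0r ?addr0.
Qed.

Lemma l2_sum_disjoint (n : nat) (D : nat -> set G) (h : nat -> E) :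
  (forall i j x, (i < j < n)%N -> D i x -> D j x -> False) ->
  N (\sum_(i < n) restr (D i) (h i)) ^+ 2 =
  \sum_(i < n) N (restr (D i) (h i)) ^+ 2.
Proof.
elim: n => [|n IH] dis; first by rewrite !big_ord0 l2norm0 expr0n.
rewrite !big_ord_recr/= -IH; last first.
  by move=> i j x /andP[ij jn]; apply: dis; rewrite ij ltnW.
apply: l2_pythagoras => x; have [xn|xn] := boolP (x \in D n); last first.
  by right; rewrite restrE (negPf xn).
left; rewrite ell2_sum big1// => i _; rewrite restrE ifF//.
apply/negP => xi; apply: (dis i n x); rewrite ?ltn_ord ?leqnn//.
  by rewrite -inE.
by rewrite -inE.
Qed.

Lemma sum_restr_le (n : nat) (D : nat -> set G) f :
  (forall i j x, (i < j < n)%N -> D i x -> D j x -> False) ->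
  \sum_(i < n) N (restr (D i) f) ^+ 2 <= N f ^+ 2.
Proof.
move=> dis; suff -> : \sum_(i < n) N (restr (D i) f) ^+ 2 =
    N (restr [set x | exists2 i, (i < n)%N & D i x] f) ^+ 2.
  by rewrite ler_pXn2r ?nnegrE// l2norm_restr.
elim: n dis => [|n IH] dis.
  rewrite big_ord0 (_ : restr _ f = 0) ?l2norm0 ?expr0n//.
  by apply: ell2_eq => x; rewrite restrE ifF//; apply/negP; rewrite inE => -[].
rewrite big_ord_recr/= IH; last first.
  by move=> i j x /andP[ij jn]; apply: dis; rewrite ij ltnW.
rewrite -l2norm_restrU; last first.
  by apply/seteqP; split=> // x [[i ilt Di] Dn]; apply: (dis i n x); rewrite ?ilt ?leqnn.
congr (N (restr _ f) ^+ 2); apply/seteqP; split=> x /=.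
  by move=> [[i ilt Di]|Dn]; [exists i => //; rewrite ltnW|exists n].
move=> [k kn Dk]; move: kn; rewrite ltnS leq_eqVlt => /orP[/eqP kn|kn].
  by right; rewrite -kn.
by left; exists k.
Qed.

(** On the translate of the complement of [D], the [i]-th conjugate of [t] takes
   its values from the translate of [D]; elsewhere its values live on the
   translate of [D].  As these translates are disjoint, both contributions
   grow only like the square root of [n]. *)
Lemma powers_estimate (n : nat) (g : nat -> G) (D : set G) t f :
  (forall x, D x \/ D (t^-1 * x)%g) ->
  (forall i j x, (i < j < n)%N -> D ((g i)^-1 * x)%g -> D ((g j)^-1 * x)%g -> False) ->
  N (\sum_(i < n) lambda (g i * t * (g i)^-1) f) <= 2 * Num.sqrt n%:R * N f.
Proof.
move=> Dt dis; pose Di i := [set x | D ((g i)^-1 * x)%g].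
pose la i := lambda (g i * t * (g i)^-1) f.
have dec i : la i = restr (Di i) (la i) +
    restr (~` Di i) (lambda (g i * t * (g i)^-1) (restr (Di i) f)).
  apply: ell2_eq => x; rewrite ell2D !restrE in_setC.
  have [xD|xD] := boolP (x \in Di i); first by rewrite [~~ _]/= addr0.
  rewrite [~~ _]/= add0r /la !lambdaE restrE mem_set//= /Di/=.
  have [xD'|] := Dt ((g i)^-1 * x)%g; first by move: xD; rewrite notin_setE.
  by rewrite !invgM invgK !mulgA mulVg mul1g.
have sn0 : 0 <= Num.sqrt n%:R :> R by exact: sqrtr_ge0.
rewrite (eq_bigr (fun i : 'I_n => restr (Di i) (la i) +
    restr (~` Di i) (lambda (g i * t * (g i)^-1) (restr (Di i) f)))); last first.
  by move=> i _; exact: dec.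
rewrite big_split/=; apply: le_trans (ler_l2normD _ _) _.
have -> : 2 * Num.sqrt n%:R * N f = Num.sqrt n%:R * N f + Num.sqrt n%:R * N f by ring.
have sq : (Num.sqrt n%:R * N f) ^+ 2 = n%:R * N f ^+ 2 by rewrite exprMn sqr_sqrtr.
apply: lerD.
  rewrite -(@ler_pXn2r _ 2)// ?nnegrE ?mulr_ge0// sq l2_sum_disjoint//.
  apply: (@le_trans _ _ (\sum_(i < n) N f ^+ 2)).
    apply: ler_sum => i _; rewrite ler_pXn2r ?nnegrE//.
    by apply: le_trans (l2norm_restr _ _) _; rewrite l2norm_lambda.
  by rewrite sumr_const card_ord mulr_natl.
apply: le_trans (ler_l2norm_sum _ _) _.
apply: (@le_trans _ _ (\sum_(i < n) N (restr (Di i) f))).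
  apply: ler_sum => i _; apply: le_trans (l2norm_restr _ _) _.
  by rewrite l2norm_lambda.
rewrite -(@ler_pXn2r _ 2)// ?nnegrE ?mulr_ge0 ?sumr_ge0// sq.
apply: le_trans (sqr_sum_le n (fun i => N (restr (Di i) f))) _.
by rewrite ler_wpM2l// sum_restr_le.
Qed.

End Powers.

(** * From almost invariant vectors to an invariant mean *)

Section InvariantMean.
Variables (R : realType) (G : groupType).
Notation E := (ell2 R G).
Notation N := (@l2norm R G).

Lemma ultra_bounded_cvg (T : Type) (U : set_system T) (phi : T -> R) :
  UltraFilter U -> (\forall x \near U, 0 <= phi x <= 1) ->
  exists l : R, phi x @[x --> U] --> l.
Proof.
move=> UU hU; have U01 : (phi x @[x --> U]) `[0, 1]%classic.
  by apply: filterS hU => x x01; rewrite /= in_itv.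
have [l [_ hl]] := @segment_compact R 0 1 _ _ U01; exists l => V lV.
have [//|UV] := in_ultra_setVsetC (phi @^-1` V) UU.
by have [x []] := hl (~` V) V UV lV.
Qed.

(** The mass which [|f|^2] puts on the subsets of [H], transported along an
   [H]-equivariant retraction of [G] onto [H], is nearly invariant when [f] is;
   an ultrafilter of better and better [f] yields an invariant mean. *)
Lemma almost_invariant_amenable (H : set G) : is_subgroup H ->
  almost_invariant R H -> amenable R H.
Proof.
move=> sH aH; have [H1 HM HV] := sH.
have [pi [piH piM]] := subgroup_retraction sH.
pose base (k : seq G * R) : set E :=
  [set f | N f = 1 /\ forall s, s \in k.1 -> N (lambda s f - f) <= k.2].
pose D : set (seq G * R) :=
  [set k : seq G * R | 0 < k.2 /\ forall s : G, s \in k.1 -> H s].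
have Dfilter : Filter (filter_from D base).
  apply: filter_from_filter; first by exists ([::], 1).
  move=> [S e] [S' e'] [/= e0 SH] [/= e0' SH']; exists (S ++ S', Num.min e e').
    split=> /=; first by rewrite lt_min e0.
    by move=> s; rewrite mem_cat => /orP[/SH|/SH'].
  move=> f [f1 /= hf]; split; split=> //= s sS.
    by have := hf s; rewrite mem_cat sS => /(_ isT); rewrite le_min => /andP[].
  by have := hf s; rewrite mem_cat sS orbT => /(_ isT); rewrite le_min => /andP[].
have Dproper : ProperFilter (filter_from D base).
  apply: filter_from_proper => -[S e] [/= e0 SH].
  by have [f fP] := aH S e e0 SH; exists f.
have [U [UU DU]] := ultraFilterLemma Dproper.
have near_base S e : 0 < e -> (forall s, s \in S -> H s) -> U (base (S, e)).
  by move=> e0 SH; apply: DU; exists (S, e).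
pose phi (A : set G) (f : E) := N (restr [set x | A (pi x)] f) ^+ 2.
have near1 : \forall f \near U, N f = 1.
  by apply: filterS (near_base [::] 1 ltr01 _) => // f [].
have phi01 A : \forall f \near U, 0 <= phi A f <= 1.
  near=> f; rewrite /phi sqr_ge0/= -(expr1n _ 2) ler_pXn2r ?nnegrE//.
  by apply: le_trans (l2norm_restr _ _) _; rewrite (near near1 f).
have cvgphi A : phi A f @[f --> U] --> lim (phi A f @[f --> U]).
  by have [l hl] := ultra_bounded_cvg UU (phi01 A); apply/cvg_ex; exists l.
exists (fun A => lim (phi A f @[f --> U])); split.
- move=> A _; apply: limr_ge; first exact: cvgphi.
  by apply: filterE => f; exact: sqr_ge0.
- apply/cvg_lim => //; apply: cvg_near_cst.
  near=> f; rewrite /phi (_ : restr _ f = f) ?(near near1 f) ?expr1n//.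
  by apply: ell2_eq => x; rewrite restrE mem_set//=; exact: piH.
- move=> A B _ _ AB; apply/cvg_lim => //.
  rewrite (_ : phi _ = fun f => phi A f + phi B f); last first.
    apply/funext => f; rewrite /phi -l2norm_restrU; last first.
      by apply/seteqP; split=> // x /= ABx; have : set0 (pi x) by rewrite -AB.
    by [].
  by apply: cvgD; exact: cvgphi.
- move=> h A Hh AH; apply/cvg_lim => //.
  have trans f : phi [set (h * a)%g | a in A] f = phi A (lambda h^-1 f).
    rewrite /phi; congr (_ ^+ 2).
    rewrite -[RHS](l2norm_lambda h); congr N; apply: ell2_eq => x.
    rewrite lambdaE !restrE lambdaE invgK mulVKg.
    have -> : (x \in [set x0 | [set (h * a)%g | a in A] (pi x0)]) =
       ((h^-1 * x)%g \in [set x0 | A (pi x0)]); last by [].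
    apply/idP/idP; rewrite !inE/= piM; try exact: HV.
      by move=> [a Aa <-]; rewrite mulKg.
    by move=> Ax; exists (h^-1 * pi x)%g => //; rewrite mulVKg.
  rewrite (_ : phi _ = fun f => phi A f + (phi [set (h * a)%g | a in A] f - phi A f));
    last by apply/funext => f; rewrite addrC subrK.
  rewrite -[X in _ --> X]addr0; apply: cvgD; first exact: cvgphi.
  apply/cvgrPdist_le => /= e e0; have e2 : 0 < e / 2 by rewrite divr_gt0.
  have Hh' s : s \in [:: h^-1%g] -> H s by rewrite inE => /eqP->; exact: HV.
  have nb := near_base _ _ e2 Hh'.
  near=> f; have [f1 /(_ h^-1%g)] : base ([:: h^-1%g], e / 2) f by near: f.
  rewrite mem_head => /(_ isT)/= hf; rewrite sub0r normrN trans /phi.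
  set P := [set x | A (pi x)]; set u := N (restr P _); set v := N (restr P f).
  have u1 : u <= 1 by rewrite -f1 -(l2norm_lambda h^-1 f) l2norm_restr.
  have v1 : v <= 1 by rewrite -f1 l2norm_restr.
  have uv : `|u - v| <= e / 2.
    apply: le_trans (ler_l2norm_dist _ _) _; rewrite -linearB.
    by apply: le_trans (l2norm_restr _ _) _.
  have -> : u ^+ 2 - v ^+ 2 = (u - v) * (u + v) by ring.
  have u0 : 0 <= u by exact: l2norm_ge0.
  have v0 : 0 <= v by exact: l2norm_ge0.
  rewrite normrM (ger0_norm (addr_ge0 u0 v0)).
  rewrite [leRHS](_ : e = e / 2 * 2); last by field.
  by apply: ler_pM => //; [exact: addr_ge0|lra].
Unshelve. all: by end_near. Qed.

End InvariantMean.

(** * Linear minorants of sublinear functionals *)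

Section MazurOrlicz.
Variables (R : realType) (V : lmodType R).
Implicit Types (p q r : V -> R) (u v x y : V).

Definition sublinear q := (forall u v, q (u + v) <= q u + q v) /\
  (forall (a : R) v, 0 < a -> q (a *: v) <= a * q v).

Lemma sublinear0 q : sublinear q -> q 0 = 0.
Proof.
move=> [qD qZ].
have : q 0 <= q 0 + q 0 by have := qD 0 0; rewrite addr0.
have : q 0 <= 2^-1 * q 0 by have := qZ 2^-1 0; rewrite scaler0; apply; rewrite invr_gt0.
lra.
Qed.

Lemma sublinearN q v : sublinear q -> - q (- v) <= q v.
Proof.
move=> sq; have := sq.1 v (- v); rewrite subrr sublinear0//.
by rewrite -lerBlDr sub0r.
Qed.

(** The two closure hypotheses hold for a chain of sublinear functionals, and for
   the functionals [p (_ + v) - c] where [p] is sublinear and [(v, c)] runs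
   through a convex cone. *)
Lemma sublinear_inf (A : set (V -> R)) :
  A !=set0 -> (forall v, has_lbound [set r v | r in A]) ->
  (forall r s u v, A r -> A s -> exists2 t, A t & t (u + v) <= r u + s v) ->
  (forall r (a : R) v, 0 < a -> A r -> exists2 t, A t & t (a *: v) <= a * r v) ->
  sublinear (fun v => inf [set r v | r in A]).
Proof.
move=> [r0 Ar0] lbA AD AZ.
have infle v r : A r -> inf [set r v | r in A] <= r v.
  by move=> Ar; apply: ge_inf; [exact: lbA|exists r].
have leinf v c : (forall r, A r -> c <= r v) -> c <= inf [set r v | r in A].
  by move=> h; apply: lb_le_inf; [exists (r0 v), r0|move=> _ [r Ar <-]; exact: h].
split.
  move=> u v; rewrite -lerBlDr; apply: (leinf) => r Ar.
  rewrite lerBlDr -lerBlDl; apply: leinf => s As; rewrite lerBlDl.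
  have [t At ht] := AD r s u v Ar As; exact: le_trans (infle _ _ At) ht.
move=> a v a0; rewrite -ler_pdivrMl//; apply: leinf => r Ar.
rewrite ler_pdivrMl//; have [t At ht] := AZ r a v a0 Ar.
exact: le_trans (infle _ _ At) ht.
Qed.

(** Zorn's lemma: the infimum of a chain of sublinear functionals below [q] is
   finite because [r v] is at least [- q (- v)]. *)
Lemma minimal_sublinear q : sublinear q -> exists p, [/\ sublinear p,
  forall v, p v <= q v &
  forall r, sublinear r -> (forall v, r v <= p v) -> r = p].
Proof.
move=> sq; pose T := {r : V -> R | `[< sublinear r /\ forall v, r v <= q v >]}.
pose rel (r s : T) := `[< forall v, sval s v <= sval r v >].
have Tsub (r : T) : sublinear (sval r) by have /asboolP[] := svalP r.
have Tle (r : T) v : sval r v <= q v by have /asboolP[_] := svalP r; apply.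
have [|||A tot|p pmax] := @Zorn T rel.
- by move=> r; apply/asboolP.
- move=> r s t /asboolP rs /asboolP st; apply/asboolP => v.
  exact: le_trans (st v) (rs v).
- move=> r s /asboolP rs /asboolP sr; apply: val_inj; apply/funext => v.
  by apply/eqP; rewrite eq_le; apply/andP; split; [exact: sr|exact: rs].
- have [[r0 Ar0]|A0] := pselect (exists w : T, A w); last first.
    have qP : `[< sublinear q /\ forall v, q v <= q v >] by apply/asboolP.
    by exists (exist _ q qP) => s As; exfalso; apply: A0; exists s.
  pose A' : set (V -> R) := [set sval w | w in A].
  have lbA v : has_lbound [set r v | r in A'].
    exists (- q (- v)) => _ [_ [r Ar <-] <-].
    by apply: le_trans (sublinearN v (Tsub r)); rewrite lerN2.
  have sA : sublinear (fun v => inf [set r v | r in A']).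
    apply: sublinear_inf => //; first by exists (sval r0), r0.
      move=> _ _ u v [r Ar <-] [s As <-]; have [/asboolP h|/asboolP h] := tot r s Ar As.
        exists (sval s); first by exists s.
        by apply: le_trans ((Tsub s).1 u v) _; rewrite lerD2r.
      exists (sval r); first by exists r.
      by apply: le_trans ((Tsub r).1 u v) _; rewrite lerD2l.
    move=> _ a v a0 [r Ar <-]; exists (sval r); first by exists r.
    exact: (Tsub r).2.
  have infle v (w : T) : A w -> inf [set r v | r in A'] <= sval w v.
    by move=> Aw; apply: ge_inf; [exact: lbA|exists (sval w) => //; exists w].
  have tP : `[< sublinear (fun v => inf [set r v | r in A']) /\
      forall v, inf [set r v | r in A'] <= q v >].
    apply/asboolP; split=> // v; exact: le_trans (infle v r0 Ar0) (Tle r0 v).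
  exists (exist _ (fun v => inf [set r v | r in A']) tP) => s As.
  by apply/asboolP => v; exact: infle.
- exists (sval p); split=> // r sr rp.
  have rP : `[< sublinear r /\ forall v, r v <= q v >].
    by apply/asboolP; split=> // v; exact: le_trans (rp v) (Tle p v).
  have := pmax (exist _ r rP); rewrite /rel => /(_ _)/(congr1 sval)/= -> //.
  by apply/asboolP.
Qed.

(** A minimal sublinear functional [p] is additive: for each [y], the infimum
   of [p (x + k *: y) - k * p y] over [k >= 0] is again sublinear in [x] and at
   most [p x], so it equals [p x]; taking [x = - y] and [k = 1] gives
   [p (- y) <= - p y]. *)
Lemma additive_minorant q : sublinear q -> exists p : V -> R,
  (forall u v, p (u + v) = p u + p v) /\ forall v, p v <= q v.
Proof.
move=> /minimal_sublinear[p [sp pq pmin]]; exists p; split=> //.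
have [pD pZ] := sp; have p0 := sublinear0 sp.
have pZ0 (k : R) v : 0 <= k -> p (k *: v) <= k * p v.
  by rewrite le_eqVlt => /orP[/eqP<-|/pZ//]; rewrite scale0r p0 mul0r.
have pN y : p (- y) <= - p y.
  pose A : set (V -> R) := [set r | exists2 k : R, 0 <= k &
    r = fun x => p (x + k *: y) - k * p y].
  have lbA x : has_lbound [set r x | r in A].
    exists (- p (- x)) => _ [_ [k k0 ->] <-].
    have h : p (k *: y) <= p (x + k *: y) + p (- x).
      by have := pD (x + k *: y) (- x); rewrite addrAC subrr add0r.
    have : k * p y <= p (k *: y).
      move: k0; rewrite le_eqVlt => /orP[/eqP<-|k0].
        by rewrite scale0r p0 mul0r.
      by rewrite -ler_pdivlMl//; have := pZ k^-1 (k *: y);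
         rewrite scalerA mulVf ?gt_eqF// scale1r invr_gt0; apply.
    lra.
  have A0 : A p by exists 0 => //; apply/funext => x; rewrite scale0r addr0 mul0r subr0.
  have Ay : A (fun x => p (x + 1 *: y) - 1 * p y) by exists 1.
  have infle x r : A r -> inf [set r x | r in A] <= r x.
    by move=> Ar; apply: ge_inf; [exact: lbA|exists r].
  have sA : sublinear (fun x => inf [set r x | r in A]).
    apply: sublinear_inf => //; first by exists p.
      move=> _ _ u v [k k0 ->] [l l0 ->].
      exists (fun x => p (x + (k + l) *: y) - (k + l) * p y).
        by exists (k + l) => //; exact: addr_ge0.
      have := pD (u + k *: y) (v + l *: y); rewrite addrACA -scalerDl mulrDl.
      lra.
    move=> _ a v a0 [k k0 ->].
    exists (fun x => p (x + (a * k) *: y) - (a * k) * p y).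
      by exists (a * k) => //; rewrite mulr_ge0// ltW.
    have := pZ a (v + k *: y) a0; rewrite scalerDr scalerA.
    rewrite mulrBr mulrA; lra.
  have := pmin _ sA (fun v => infle v p A0) => /(congr1 (fun r => r (- y))) <-.
  apply: le_trans (infle _ _ Ay) _.
  by rewrite scale1r addNr p0 mul1r sub0r.
move=> u v; apply/eqP; rewrite eq_le pD/=.
have := pD (- u) (- v); have := pN u; have := pN v.
have := sublinearN (u + v) sp; rewrite opprD.
lra.
Qed.

(** If [p] dominates the affine constraints collected in a convex cone [P],
   some additive functional below [p] satisfies all of them. *)
Lemma mazur_orlicz p (P : set (V * R)) : sublinear p -> P (0, 0) ->
  (forall a b, P a -> P b -> P (a.1 + b.1, a.2 + b.2)) ->
  (forall (k : R) a, 0 < k -> P a -> P (k *: a.1, k * a.2)) ->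
  (forall a, P a -> a.2 <= p a.1) ->
  exists phi : V -> R, [/\ forall u v, phi (u + v) = phi u + phi v,
    forall v, phi v <= p v & forall a, P a -> a.2 <= phi a.1].
Proof.
move=> sp P0 PD PZ Pp; have [pD pZ] := sp.
pose A : set (V -> R) := [set r | exists2 a, P a & r = fun v => p (v + a.1) - a.2].
have lbA v : has_lbound [set r v | r in A].
  exists (- p (- v)) => _ [_ [a Pa ->] <-].
  have := pD (v + a.1) (- v); rewrite addrAC subrr add0r.
  have := Pp _ Pa; lra.
have Ap : A p by exists (0, 0) => //; apply/funext => v; rewrite addr0 subr0.
have infle v r : A r -> inf [set r v | r in A] <= r v.
  by move=> Ar; apply: ge_inf; [exact: lbA|exists r].
have sA : sublinear (fun v => inf [set r v | r in A]).
  apply: sublinear_inf => //; first by exists p.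
    move=> _ _ u v [a Pa ->] [b Pb ->].
    exists (fun v => p (v + (a.1 + b.1)) - (a.2 + b.2)).
      by exists (a.1 + b.1, a.2 + b.2) => //; exact: PD.
    have := pD (u + a.1) (v + b.1); rewrite addrACA; lra.
  move=> _ k v k0 [a Pa ->].
  exists (fun v => p (v + k *: a.1) - k * a.2).
    by exists (k *: a.1, k * a.2) => //; exact: PZ.
  have := pZ k (v + a.1) k0; rewrite scalerDr mulrBr; lra.
have [phi [phiD phiA]] := additive_minorant sA; exists phi; split=> //.
  by move=> v; apply: le_trans (phiA v) (infle _ _ Ap).
move=> a Pa; have Aa : A (fun v => p (v + a.1) - a.2) by exists a.
have phi0 : phi 0 = 0 by have := phiD 0 0; rewrite addr0; lra.
have phiN : phi (- a.1) = - phi a.1.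
  by have := phiD (- a.1) a.1; rewrite addNr phi0; lra.
have := le_trans (phiA (- a.1)) (infle _ _ Aa).
rewrite addNr sublinear0// phiN; lra.
Qed.

End MazurOrlicz.

(** * From an invariant mean to almost invariant vectors *)

Section EllOne.
Variables (R : realType) (G : groupType).

Definition absnorm (f : G -> R) : \bar R := (\esum_(g in [set: G]) `|f g|%:E)%E.

Lemma absnorm_ge0 f : (0 <= absnorm f)%E.
Proof. by apply: esum_ge0 => x _; rewrite lee_fin. Qed.

Lemma absnormD f g : (absnorm (fun x => (f x + g x)%R) <= absnorm f + absnorm g)%E.
Proof.
rewrite /absnorm -esumD; try by move=> *; rewrite lee_fin.
by apply: le_esum => x _; rewrite -EFinD lee_fin ler_normD.
Qed.

Lemma absnormZ_le (a : R) f : (absnorm (fun x => (a * f x)%R) <= `|a|%:E * absnorm f)%E.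
Proof.
apply: ge_ereal_sup => _ [F [Ffin FT] <-].
under eq_fsbigr do rewrite normrM EFinM.
rewrite -ge0_mule_fsumr; last by move=> x; rewrite lee_fin.
by apply: lee_wpmul2l; rewrite ?lee_fin//; apply: ereal_sup_ubound; exists F.
Qed.

Definition l1 : {pred G -> R^o} := [pred f | (absnorm f < +oo)%E].

Lemma l1_submod_closed : submod_closed l1.
Proof.
split.
  by rewrite inE /= /absnorm esum1 ?ltry// => g _; rewrite [_ g]/(0 : R) normr0.
move=> a f g; rewrite !inE /= => f1 g1.
apply: le_lt_trans (absnormD (fun x => a * f x) g) _.
rewrite lte_add_pinfty//; apply: le_lt_trans (absnormZ_le a f) _.
by apply: lte_mul_pinfty.
Qed.

HB.instance Definition _ := GRing.isSubmodClosed.Build _ _ l1 l1_submod_closed.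

Record ell1 := Ell1 { ell1_val :> G -> R^o ; _ : ell1_val \in l1 }.

HB.instance Definition _ := [isSub for ell1_val].
HB.instance Definition _ := [Choice of ell1 by <:].
HB.instance Definition _ := [SubChoice_isSubLmodule of ell1 by <:].

Implicit Types (f g : ell1) (s t x y : G).

Definition l1norm f : R := fine (absnorm f).

Lemma l1norm_ge0 f : 0 <= l1norm f.
Proof. by rewrite fine_ge0// absnorm_ge0. Qed.

Lemma l1normE f : (l1norm f)%:E = absnorm f.
Proof.
rewrite /l1norm fineK// ge0_fin_numE ?absnorm_ge0//.
by case: f => f /= h; rewrite inE in h.
Qed.

Lemma ell1_eq f g : (forall x, f x = g x) -> f = g.
Proof. by move=> fg; apply: val_inj; apply/funext. Qed.

Lemma ell1D f g x : (f + g) x = f x + g x. Proof. by []. Qed.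
Lemma ell10 x : (0 : ell1) x = 0. Proof. by []. Qed.
Lemma ell1Z (a : R) f x : (a *: f) x = a * f x. Proof. by []. Qed.

Lemma ler_l1normD f g : l1norm (f + g) <= l1norm f + l1norm g.
Proof. by rewrite -lee_fin EFinD !l1normE; exact: (absnormD f g). Qed.

Lemma l1normD_ge0 f g : (forall x, 0 <= f x) -> (forall x, 0 <= g x) ->
  l1norm (f + g) = l1norm f + l1norm g.
Proof.
move=> f0 g0; apply: EFin_inj; rewrite EFinD !l1normE /absnorm -esumD//.
by apply: eq_esum => x _; rewrite -EFinD ell1D !ger0_norm ?addr_ge0.
Qed.

Lemma l1normZ (a : R) f : l1norm (a *: f) = `|a| * l1norm f.
Proof.
have le1 b g : l1norm (b *: g) <= `|b| * l1norm g.
  by rewrite -lee_fin EFinM !l1normE; exact: (absnormZ_le b g).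
apply/eqP; rewrite eq_le le1/=; have [->|a0] := eqVneq a 0.
  by rewrite normr0 mul0r l1norm_ge0.
rewrite -ler_pdivlMl ?normr_gt0//.
have := le1 a^-1 (a *: f); rewrite scalerA mulVf// scale1r normrV ?unitfE//.
Qed.

Lemma l1norm0 : l1norm 0 = 0.
Proof. by rewrite -(scale0r 0) l1normZ normr0 mul0r. Qed.

Lemma l1normN f : l1norm (- f) = l1norm f.
Proof. by rewrite -scaleN1r l1normZ normrN1 mul1r. Qed.

Fact l1_translate s f : (fun x => f (s^-1 * x)%g : R^o) \in l1.
Proof.
have : ell1_val f \in l1 by case: f.
rewrite !inE /= /absnorm.
rewrite (@reindex_esum _ _ _ [set: G] [set: G] (fun x => (s^-1 * x)%g))//.
split=> //; first by move=> x y _ _ /mulgI.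
by move=> x _; exists (s * x)%g => //; rewrite mulKg.
Qed.

Definition translate1 s f : ell1 := Ell1 (l1_translate s f).

Lemma translate1E s f x : translate1 s f x = f (s^-1 * x)%g. Proof. by []. Qed.

Lemma absnorm_delta x : absnorm (fun y => (y == x)%:R) = 1%E.
Proof.
rewrite -(esum_indicator R x); apply: eq_esum => y _.
by case: eqP => _; rewrite ?normr1 ?normr0.
Qed.

Fact delta1_subproof x : (fun y => (y == x)%:R : R^o) \in l1.
Proof. by rewrite inE /= absnorm_delta ltry. Qed.

Definition delta1 x : ell1 := Ell1 (delta1_subproof x).

Lemma delta1E x y : delta1 x y = (y == x)%:R. Proof. by []. Qed.

Lemma l1norm_delta x : l1norm (delta1 x) = 1.
Proof. by rewrite /l1norm absnorm_delta. Qed.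

Lemma translate1_delta s x : translate1 s (delta1 x) = delta1 (s * x).
Proof.
apply: ell1_eq => y; rewrite translate1E !delta1E.
by rewrite -(inj_eq (mulgI s)) mulVKg.
Qed.

End EllOne.

Section DayTheorem.
Variables (R : realType) (G : groupType).
Notation E := (ell2 R G).
Notation N := (@l2norm R G).
Notation E1 := (ell1 R G).
Implicit Types (s x y : G) (H : set G).

(** Integrating both sides of a pointwise inequality against the mean: bounded
   integer-valued functions and their translates have the same integral, which
   is a finite sum here because only finitely many values occur. *)
Lemma mean_no_drift H (m : set G -> R) (n M : nat) (s : 'I_n -> G)
    (k : 'I_n -> G -> nat) : is_subgroup H ->
  [/\ forall A, A `<=` H -> 0 <= m A, m H = 1,
    forall A B, A `<=` H -> B `<=` H -> A `&` B = set0 ->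
      m (A `|` B) = m A + m B
    & forall h A, H h -> A `<=` H -> m [set (h * a)%g | a in A] = m A] ->
  (forall i, H (s i)) -> (forall i x, (k i x <= M)%N) ->
  exists2 x, H x & (\sum_i k i (s i * x)%g <= \sum_i k i x)%N.
Proof.
move=> [H1 HM HV] [m0 m1 mU mI] Hs kM; apply: contrapT => hcon.
have {hcon}drift x : H x -> (\sum_i k i x < \sum_i k i (s i * x)%g)%N.
  by move=> Hx; rewrite ltnNge; apply/negP => h; apply: hcon; exists x.
have mset0 : m set0 = 0.
  have := mU set0 set0 (@sub0set _ _) (@sub0set _ _) (setI0 _).
  rewrite setU0; lra.
pose T := {ffun 'I_n -> 'I_M.+1 * 'I_M.+1}.
pose tau x : T := [ffun i => (inord (k i (s i * x)%g), inord (k i x))].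
pose fib (P : pred T) : set G := [set x | H x /\ P (tau x)].
have fibH P : fib P `<=` H by move=> x [].
pose w t := m (fib (pred1 t)).
have w0 t : 0 <= w t by exact/m0/fibH.
have push (P : pred T) : \sum_(t | P t) w t = m (fib P).
  have seqP (r : seq T) : uniq r ->
      \sum_(t <- r | P t) w t = m (fib [pred t | (t \in r) && P t]).
    elim: r => [_|t r IH /= /andP[tr ur]].
      rewrite big_nil (_ : fib _ = set0) ?mset0//.
      by apply/seteqP; split=> // x [].
    rewrite big_cons IH//; case: ifP => Pt.
      rewrite -mU; [|exact: fibH|exact: fibH|].
        congr m; apply/seteqP; split=> x.
          move=> [[Hx /= /eqP xt]|[Hx /= /andP[xr Px]]]; split=> //=.
            by rewrite inE xt eqxx Pt.
          by rewrite inE xr orbT.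
        move=> [Hx /=]; rewrite inE => /andP[/orP[/eqP xt|xr] Px].
          by left; split=> //=; rewrite xt.
        by right; split=> //=; rewrite xr.
      apply/seteqP; split=> // x [[_ /= /eqP xt] [_ /= /andP[]]].
      by rewrite xt (negPf tr).
    congr m; apply/seteqP; split=> x [Hx /=]; rewrite ?inE => /andP[xr Px]; split=> //=.
      by rewrite inE xr orbT.
    move: xr; rewrite Px andbT => /orP[/eqP xt|//].
    by rewrite -xt Px in Pt.
  rewrite seqP ?index_enum_uniq//; congr m.
  by apply/seteqP; split=> x [Hx h]; split=> //; move: h; rewrite /= mem_index_enum.
have tau1 x i : (tau x i).1 = k i (s i * x)%g :> nat by rewrite ffunE inordK// ltnS.
have tau2 x i : (tau x i).2 = k i x :> nat by rewrite ffunE inordK// ltnS.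
have int1 i : \sum_t w t * (t i).1%:R =
    \sum_(j < M.+1) m [set x | H x /\ k i x = j] * j%:R.
  rewrite (partition_big (fun t : T => (t i).1) xpredT)//=.
  apply: eq_bigr => j _.
  rewrite (eq_bigr (fun t => w t * j%:R)); last by move=> t /eqP->.
  rewrite -mulr_suml push -(mI (s i)) //; congr (m _ * _).
  apply/seteqP; split=> x.
    move=> [y [Hy /= /eqP hj] <-]; split; first exact: HM.
    by rewrite -hj tau1.
  move=> [Hx kx]; exists ((s i)^-1 * x)%g; last by rewrite mulVKg.
  split; first exact: HM (HV _ (Hs i)) Hx.
  by apply/eqP/val_inj; rewrite /= tau1 mulVKg.
have int2 i : \sum_t w t * (t i).2%:R =
    \sum_(j < M.+1) m [set x | H x /\ k i x = j] * j%:R.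
  rewrite (partition_big (fun t : T => (t i).2) xpredT)//=.
  apply: eq_bigr => j _.
  rewrite (eq_bigr (fun t => w t * j%:R)); last by move=> t /eqP->.
  rewrite -mulr_suml push; congr (m _ * _).
  apply/seteqP; split=> x.
    by move=> [Hx /= /eqP hj]; split=> //; rewrite -hj tau2.
  by move=> [Hx kx]; split=> //=; apply/eqP/val_inj; rewrite /= tau2.
have tot : \sum_t w t = 1.
  by rewrite (push xpredT) -m1; congr m; apply/seteqP; split=> x; [case|split].
have : \sum_t w t <= \sum_t (w t * (\sum_i (t i).1)%:R - w t * (\sum_i (t i).2)%:R).
  apply: ler_sum => t _; rewrite -mulrBr.
  have [[x Hx xt]|ex] := pselect (exists2 x, H x & tau x = t); last first.
    suff -> : w t = 0 by rewrite mul0r.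
    rewrite /w (_ : fib _ = set0)//; apply/seteqP; split=> // x [Hx /= /eqP xt].
    by apply: ex; exists x.
  rewrite ler_peMr// lerBrDl natr1 ler_nat -xt.
  under eq_bigr do rewrite tau2.
  under [X in (_ < X)%N]eq_bigr do rewrite tau1.
  exact: drift.
rewrite tot sumrB.
have mv (F : T -> 'I_n -> 'I_M.+1) : \sum_t w t * (\sum_i F t i)%:R =
    \sum_i \sum_t w t * (F t i)%:R.
  rewrite exchange_big; apply: eq_bigr => t _.
  by rewrite natr_sum mulr_sumr.
rewrite (mv (fun t i => (t i).1)) (mv (fun t i => (t i).2)).
under eq_bigr do rewrite int1.
under [X in _ - X]eq_bigr do rewrite int2.
by rewrite subrr ler10.
Qed.

(** Were there no almost invariant nonnegative summable function, the
   Mazur-Orlicz lemma would produce bounded functions on [H] whose total drift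
   is everywhere at least [e]; rounding them down contradicts the lemma
   above. *)
Lemma amenable_almost_invariant_l1 H (n : nat) (s : 'I_n -> G) (e : R) :
  is_subgroup H -> amenable R H -> (forall i, H (s i)) -> 0 < e ->
  exists f : E1, [/\ forall x, 0 <= f x, forall x, ~ H x -> f x = 0
    & \sum_i l1norm (translate1 (s i) f - f) < e * l1norm f].
Proof.
move=> sH [m mP] Hs e0; have [H1 HM HV] := sH.
pose V : lmodType R := 'I_n -> E1.
pose D (f : E1) : V := fun i => translate1 (s i) f - f.
pose C (f : E1) := (forall x, 0 <= f x) /\ forall x, ~ H x -> f x = 0.
pose p (w : V) := \sum_i l1norm (w i).
apply: contrapT => /forallNP hcon.
have lower f : C f -> e * l1norm f <= p (D f).
  by move=> [f0 fH]; rewrite leNgt; apply/negP => h; apply: (hcon f).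
pose P : set (V * R) := [set a | exists2 f, C f & a = (D f, e * l1norm f)].
have sp : sublinear p.
  split=> [u v|a v a0]; rewrite /p.
    by rewrite -big_split; apply: ler_sum => i _; exact: ler_l1normD.
  rewrite mulr_sumr; apply: ler_sum => i _.
  change (l1norm (a *: v i) <= a * l1norm (v i)).
  by rewrite l1normZ gtr0_norm.
have C0 : C 0 by split=> x; rewrite ell10.
have DD f g : D (f + g) = D f + D g.
  apply/funext => i; apply: ell1_eq => x.
  change (f ((s i)^-1 * x)%g + g ((s i)^-1 * x)%g - (f x + g x) =
    (f ((s i)^-1 * x)%g - f x) + (g ((s i)^-1 * x)%g - g x)).
  by rewrite opprD addrACA.
have DZ (a : R) f : D (a *: f) = a *: D f.
  apply/funext => i; apply: ell1_eq => x.
  change (a * f ((s i)^-1 * x)%g - a * f x = a * (f ((s i)^-1 * x)%g - f x)).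
  by rewrite mulrBr.
have [|||a [f Cf ->]|phi [phiD phip phiP]] := @mazur_orlicz R V p P sp.
- exists 0 => //; rewrite l1norm0 mulr0; congr pair.
  by have := DZ 0 0; rewrite !scale0r => ->.
- move=> _ _ [f [f0 fH] ->] [g [g0 gH] ->]; exists (f + g).
    by split=> x; rewrite ell1D ?addr_ge0// => nH; rewrite fH ?gH ?addr0.
  by rewrite /= DD l1normD_ge0// mulrDr.
- move=> a _ a0 [f [f0 fH] ->]; exists (a *: f).
    split=> x; rewrite ell1Z ?mulr_ge0 ?(ltW a0)// => nH; by rewrite fH ?mulr0.
  by rewrite /= DZ l1normZ gtr0_norm// mulrCA.
- exact: lower.
have phi0 : phi 0 = 0 by have := phiD 0 0; rewrite addr0; lra.
have phiN v : phi (- v) = - phi v by have := phiD (- v) v; rewrite addNr phi0; lra.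
have phis (F : 'I_n -> V) : phi (\sum_i F i) = \sum_i phi (F i).
  exact: (big_morph phi phiD phi0).
pose single (i : 'I_n) x : V := fun j => if j == i then delta1 R x else 0.
have psingle i x : p (single i x) = 1.
  rewrite /p (bigD1 i)//= big1 ?addr0 /single ?eqxx ?l1norm_delta//.
  by move=> j /negPf->; rewrite l1norm0.
have pN v : p (- v) = p v by apply: eq_bigr => i _; exact: l1normN.
(* In units of [e / n.+1] the drift is at least [n.+1], and rounding down the
   [n] summands loses less than [n]. *)
pose z i x := (phi (single i x) + 1) / (e / n.+1%:R).
have d0 : 0 < e / n.+1%:R by rewrite divr_gt0.
have z0 i x : 0 <= z i x.
  apply: divr_ge0; last exact: ltW.
  by have := phip (- single i x); rewrite pN psingle phiN; lra.
have zM i x : z i x <= 2 / (e / n.+1%:R).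
  rewrite ler_pM2r ?invr_gt0//.
  by have := phip (single i x); rewrite psingle; lra.
have [x Hx] := @mean_no_drift H m n (Num.truncn (2 / (e / n.+1%:R))) s
  (fun i x => Num.truncn (z i x)) sH mP Hs (fun i x => le_truncn (zM i x)).
apply/negP; rewrite -ltnNge -(ltr_nat R).
have Cd : C (delta1 R x).
  split=> y; rewrite delta1E ?ler0n// => nHy.
  by case: eqP => // yx; exfalso; apply: nHy; rewrite yx.
have := phiP (D (delta1 R x), e * l1norm (delta1 R x)).
rewrite /= l1norm_delta mulr1 => /(_ (ex_intro2 _ _ _ Cd _)).
rewrite l1norm_delta mulr1 => /(_ erefl).
have singleB i a b j : (single i a - single i b) j =
    if j == i then delta1 R a - delta1 R b else 0.
  change (single i a j - single i b j = if j == i then delta1 R a - delta1 R b else 0).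
  rewrite /single; case: ifP => _ //; exact: subrr.
have -> : D (delta1 R x) = \sum_i (single i (s i * x)%g - single i x).
  apply/funext => j; rewrite fct_sumE (bigD1 j)//= big1 => [|i ij]; rewrite singleB.
    by rewrite eqxx addr0 /D translate1_delta.
  by rewrite eq_sym (negPf ij).
rewrite phis => drift.
have zdrift : n.+1%:R <= \sum_i (z i (s i * x)%g - z i x).
  rewrite (eq_bigr (fun i : 'I_n => phi (single i (s i * x)%g - single i x) / (e / n.+1%:R))).
    by rewrite -mulr_suml ler_pdivlMr// mulrC divfK ?pnatr_eq0.
  by move=> i _; rewrite phiD phiN /z; ring.
have tr1 (c : R) : 0 <= c -> (Num.truncn c)%:R <= c < (Num.truncn c).+1%:R.
  exact: truncn_itv.
rewrite !natr_sum; rewrite sumrB in zdrift.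
have le1 : \sum_i (Num.truncn (z i x))%:R <= \sum_i z i x.
  by apply: ler_sum => i _; have /andP[] := tr1 _ (z0 i x).
have le2 : \sum_i z i (s i * x)%g <= \sum_i (Num.truncn (z i (s i * x)%g))%:R + n%:R.
  rewrite -[n in n%:R]card_ord -sumr_const -big_split/=; apply: ler_sum => i _.
  by have /andP[_] := tr1 _ (z0 i (s i * x)%g); rewrite -natr1 => /ltW.
rewrite -natr1 in zdrift; lra.
Qed.

(** The square root of an almost invariant summable function is almost
   invariant in [ell2], since [(sqrt a - sqrt b)^2 <= |a - b|]. *)
Lemma amenable_almost_invariant H (S : seq G) (e : R) :
  is_subgroup H -> amenable R H -> (forall s, s \in S -> H s) -> 0 < e ->
  exists f : E, [/\ N f = 1, forall x, ~ H x -> f x = 0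
    & forall s, s \in S -> N (lambda s f - f) <= e].
Proof.
move=> sH aH SH e0.
have Hs (i : 'I_(size S)) : H (nth 1%g S i) by apply: SH; exact: mem_nth.
have [f [f0 fH hf]] := amenable_almost_invariant_l1 sH aH Hs (exprn_gt0 2 e0).
have fgt0 : 0 < l1norm f.
  rewrite -(pmulr_rgt0 _ (exprn_gt0 2 e0)); apply: le_lt_trans hf.
  by apply: sumr_ge0 => i _; exact: l1norm_ge0.
pose xi x : R[i]^o := ((Num.sqrt (f x))%:C)%C.
have xiE : sqnorm2 xi = (l1norm f)%:E.
  rewrite l1normE; apply: eq_esum => x _.
  by rewrite normc_real ger0_norm ?sqrtr_ge0// sqr_sqrtr// ger0_norm.
have xi2 : xi \in @l2 R G by rewrite inE /= xiE ltry.
pose X : E := Ell2 xi2.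
have XN : N X ^+ 2 = l1norm f by apply: EFin_inj; rewrite l2norm_sqr xiE.
have Xgt0 : 0 < N X.
  by rewrite lt_neqAle l2norm_ge0 andbT eq_sym -sqrf_eq0 XN gt_eqF.
have nV : normc ((N X)^-1%:C)%C = (N X)^-1.
  by rewrite normc_real ger0_norm// invr_ge0 ltW.
exists (((N X)^-1%:C)%C *: X); split.
- by rewrite l2normZ nV mulVf// gt_eqF.
- move=> x nHx; rewrite ell2Z [X x]/(xi x) /xi fH// sqrtr0.
  by rewrite [X in _ * X](_ : _ = 0)// mulr0.
- move=> s sS; rewrite linearZ /= -scalerBr l2normZ nV ler_pdivrMl//.
  rewrite -(@ler_pXn2r _ 2)// ?nnegrE// ?mulr_ge0 ?(ltW e0)//.
  rewrite exprMn XN mulrC.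
  apply: (@le_trans _ _ (l1norm (translate1 s f - f))); last first.
    apply: le_trans (ltW hf).
    have si : (index s S < size S)%N by rewrite index_mem.
    rewrite (bigD1 (Ordinal si))//= nth_index//.
    by rewrite lerDl sumr_ge0// => i _; exact: l1norm_ge0.
  rewrite -lee_fin l2norm_sqr l1normE; apply: le_esum => x _.
  rewrite lee_fin ell2B lambdaE.
  change (normc ((Num.sqrt (f (s^-1 * x)%g))%:C%C - (Num.sqrt (f x))%:C%C) ^+ 2
    <= `|f (s^-1 * x)%g - f x|).
  rewrite -(rmorphB (real_complex R)) normc_real real_normK ?num_real//.
  have a0 := f0 (s^-1 * x)%g; have b0 := f0 x.
  set a : R := f _ in a0 *; set b : R := f x in b0 *.
  rewrite -[in leRHS](sqr_sqrtr a0) -[in leRHS](sqr_sqrtr b0).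
  have := sqrtr_ge0 a; have := sqrtr_ge0 b.
  move: (Num.sqrt a) (Num.sqrt b) => c d d0 c0.
  rewrite subr_sqr normrM (ger0_norm (addr_ge0 c0 d0)).
  rewrite -real_normK ?num_real// expr2 ler_wpM2l//.
  by rewrite (le_trans (ler_normB _ _))// !ger0_norm.
Qed.

End DayTheorem.

(** * Ideals detected by amenable stabilizers *)

Section AmenableStabilizer.
Variables (R : realType) (G : groupType) (X : topologicalType).
Variable act : G -> X -> X.
Hypothesis act1 : forall x, act 1%g x = x.
Hypothesis actM : forall g h x, act (g * h)%g x = act g (act h x).
Notation E := (ell2 R G).
Notation N := (@l2norm R G).
Implicit Types (c d : seq (R[i] * G)) (g h : G) (x y z : X) (T : E -> E).

Lemma actK g x : act (g^-1)%g (act g x) = x.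
Proof. by rewrite -actM mulVg act1. Qed.

Lemma actKV g x : act g (act (g^-1)%g x) = x.
Proof. by rewrite -actM mulgV act1. Qed.

Lemma act_eqV g x y : (act g x == y) = (x == act (g^-1)%g y).
Proof. by apply/eqP/eqP => [<-|->]; rewrite ?actK ?actKV. Qed.

Lemma stabilizer_subgroup x : is_subgroup (stabilizer act x).
Proof.
split=> [|g h|g]; rewrite /stabilizer/=; first exact: act1.
  by move=> gx hx; rewrite actM hx.
by move=> gx; rewrite -[in LHS]gx actK.
Qed.

(** The formal combinations which act as zero on the finitely supported
   functions on [X], read through the regular representation. *)
Definition permutation_kernel : set (E -> E) :=
  [set T | exists2 c, T = lambda_sum c &
    forall y z, \sum_(p <- c | act p.2 y == z) p.1 = 0].

Lemma permutation_kernel_regular : permutation_kernel `<=` @regular_group_algebra R G.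
Proof. by move=> _ [c -> _]; exact: lambda_sum_regular. Qed.

Lemma permutation_kernelZD (a : R[i]) T U :
  permutation_kernel T -> permutation_kernel U -> permutation_kernel (a *: T + U).
Proof.
move=> [c -> c0] [d -> d0]; rewrite lambda_sumZD.
exists ([seq (a * p.1, p.2) | p <- c] ++ d) => // y z.
rewrite big_cat big_map/= d0 addr0.
by have := c0 y z => /(congr1 (fun b => a * b)); rewrite mulr0 mulr_sumr.
Qed.

Lemma permutation_kernelMl T U : regular_group_algebra T -> permutation_kernel U ->
  permutation_kernel (T \o U).
Proof.
move=> [d ->] [c -> c0]; rewrite -/(lambda_sum d) lambda_sumM.
exists [seq (p.1 * q.1, (p.2 * q.2)%g) | p <- d, q <- c] => // y z.
rewrite big_mkcond big_allpairs_dep/= big1// => p _.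
rewrite -big_mkcond/= -mulr_sumr.
rewrite (eq_bigl (fun q => act q.2 y == act (p.2^-1)%g z)) ?c0 ?mulr0// => q.
by rewrite actM act_eqV.
Qed.

Lemma permutation_kernelMr T U : permutation_kernel T -> regular_group_algebra U ->
  permutation_kernel (T \o U).
Proof.
move=> [c -> c0] [d ->]; rewrite -/(lambda_sum d) lambda_sumM.
exists [seq (p.1 * q.1, (p.2 * q.2)%g) | p <- c, q <- d] => // y z.
rewrite big_mkcond big_allpairs_dep/= exchange_big big1//= => q _.
rewrite -big_mkcond/= -mulr_suml.
rewrite (eq_bigl (fun p => act p.2 (act q.2 y) == z)) ?c0 ?mul0r// => p.
by rewrite actM.
Qed.

Lemma permutation_kernel_bounded : permutation_kernel `<=` @bounded_operator R G.
Proof. by move=> T /permutation_kernel_regular; exact: regular_bounded. Qed.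

(** The kernel is already an ideal of the group algebra, so its closure is an
   ideal of the completion. *)
Lemma permutation_kernel_ideal :
  closed_two_sided_ideal (@reduced_Cstar_algebra R G) (opclosure permutation_kernel).
Proof.
have bJ := permutation_kernel_bounded; have bC := @regular_bounded R G.
split.
- exact: opclosureS permutation_kernel_regular.
- split; last exact: opclosureZD bJ permutation_kernelZD.
  apply: sub_opclosure => //; exists [::]; first by rewrite /lambda_sum big_nil.
  by move=> y z; rewrite big_nil.
- move=> T U AT IU; split.
    exact (opclosureM bC bJ bJ (@permutation_kernelMl) AT IU).
  exact (opclosureM bJ bC bJ (@permutation_kernelMr) IU AT).
- exact: opclosure_idem.
Qed.

(** If the stabilizer [H] of [x] is amenable, almost invariant vectors supported
   in [H] represent the point mass at [x] approximately: an element [c] of the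
   kernel moves such a vector almost orthogonally to [H], because the
   coefficients of [c] on [H] sum to [0].  Hence the kernel stays at distance
   [1] from the identity. *)
Lemma id_notin_permutation_kernel x : amenable R (stabilizer act x) ->
  ~ opclosure permutation_kernel (@id E).
Proof.
move=> aH /(opclosureP _ permutation_kernel_bounded)[_ hid].
have [_ [c -> c0] hc] := hid 2^-1 (ltac:(by rewrite invr_gt0)).
set H := stabilizer act x in aH.
pose K : R := \sum_(p <- c) normc p.1 + 1.
have K0' : 0 <= \sum_(p <- c) normc p.1 by apply: sumr_ge0 => p _; exact: normc_ge0.
have K0 : 0 < K by rewrite ltr_wpDl.
have e0 : 0 < (4 * K)^-1 by rewrite invr_gt0 mulr_gt0.
have SH s : s \in [seq p.2 | p <- c & act p.2 x == x] -> H s.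
  by move=> /mapP[p]; rewrite mem_filter => /andP[/eqP px _] ->.
have [xi [xi1 xiH hxi]] :=
  amenable_almost_invariant (stabilizer_subgroup x) aH SH e0.
have := hc xi; rewrite xi1 mulr1; apply/negP; rewrite -ltNge.
apply: lt_le_trans (l2norm_restr H _).
have [H1 HM HV] := stabilizer_subgroup x.
have inH g : (g \in H) = (act g x == x).
  by apply/idP/eqP; rewrite inE.
have rE : restr H (xi - lambda_sum c xi) =
    xi - \sum_(p <- c | act p.2 x == x) p.1 *: (lambda p.2 xi - xi).
  rewrite linearB /=; congr (_ - _).
    apply: ell2_eq => g; rewrite restrE; case: ifPn => // gH.
    by rewrite xiH// => Hg; move/negP: gH; apply; rewrite inE.
  under [RHS]eq_bigr do rewrite scalerBr.
  rewrite sumrB -scaler_suml c0 scale0r subr0 lambda_sumE linear_sum.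
  rewrite [RHS]big_mkcond; apply: eq_bigr => p _; rewrite linearZ /=.
  apply: ell2_eq => g; case: ifP => px.
    rewrite !ell2Z restrE lambdaE; case: ifPn => // gH.
    rewrite xiH ?mulr0// => Hg; move/negP: gH; apply; rewrite inE.
    by rewrite -[g](mulVKg p.2); apply: HM => //; exact/eqP.
  rewrite ell2Z ell20 restrE lambdaE; case: ifPn => gH; last by rewrite mulr0.
  rewrite xiH ?mulr0// => Hg; move/negP: px; apply; rewrite -inH inE.
  rewrite inE in gH; have := HM _ _ gH (HV _ Hg).
  by rewrite invgM invgK mulgA mulgV mul1g.
rewrite rE; set r := \sum_(p <- c | _) _.
have rN : N r <= 4^-1.
  rewrite /r -big_filter; apply: le_trans (ler_l2norm_sum _ _) _.
  rewrite big_filter; apply: (@le_trans _ _ (\sum_(p <- c) normc p.1 * (4 * K)^-1)).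
    rewrite big_mkcond big_seq [leRHS]big_seq; apply: ler_sum => p pc.
    case: ifP => px; last by rewrite mulr_ge0 ?normc_ge0// ltW.
    rewrite l2normZ ler_wpM2l ?normc_ge0//; apply: hxi; apply/mapP.
    by exists p; rewrite ?mem_filter ?px.
  rewrite -mulr_suml ler_pdivrMr ?mulr_gt0//.
  by rewrite mulrA mulVf ?mul1r ?lerDl.
have := ler_l2normD (xi - r) r; rewrite subrK xi1.
have : 4^-1 * 2 = 2^-1 :> R by field.
have : 0 < 4^-1 :> R by rewrite invr_gt0.
lra.
Qed.

(** When [g] and [h] have complementary fixed points, [(1 - g) (1 - h)] acts as
   zero on functions on [X], since [g] fixes both [y] and [h y] whenever [h]
   moves [y]; its coefficient at [1] is [1] or [2]. *)
Lemma amenable_stabilizer_not_simple x g h : amenable R (stabilizer act x) ->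
  g <> 1%g -> h <> 1%g -> (forall y, act g y = y \/ act h y = y) ->
  ~ Cstar_simple R G.
Proof.
move=> aH g1 h1 gh [_ /(_ _ permutation_kernel_ideal)[I0|IA]]; last first.
  by apply: (id_notin_permutation_kernel aH); rewrite IA; exact: reduced_id.
pose c : seq (R[i] * G) := [:: (1, 1%g); (-1, g); (-1, h); (1, (g * h)%g)].
have Jc : permutation_kernel (lambda_sum c).
  exists c => // y z; rewrite !big_cons big_nil /= act1 actM.
  have [gy|hy] := gh y; last first.
    by rewrite hy; case: (y == z); case: (act g y == z) => /=; ring.
  have [ghy|hhy] := gh (act h y).
    by rewrite gy ghy; case: (y == z); case: (act h y == z) => /=; ring.
  have hy : act h y = y by rewrite -[in RHS](actK h y) -[in RHS]hhy actK.
  by rewrite hy gy; case: (y == z) => /=; ring.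
have : opclosure permutation_kernel (lambda_sum c).
  by apply: sub_opclosure => //; exact: permutation_kernel_bounded.
rewrite I0 => c0; have : lambda_sum c (delta R 1%g) 1%g = 0 by rewrite c0.
rewrite lambda_sum_delta1 !big_cons big_nil /= eqxx.
rewrite (introF eqP g1) (introF eqP h1) addr0.
case: ifP => _ /eqP; last by rewrite addr0 oner_eq0.
by rewrite (_ : 1 + 1 = 2%:R :> R[i]) ?pnatr_eq0.
Qed.

End AmenableStabilizer.

(** * Topological dynamics *)

(** Baire category: the frontier of a closed set is nowhere dense, and in a
   compact Hausdorff space some point avoids countably many frontiers. *)
Lemma compact_generic_point (X : topologicalType) (Z : nat -> set X) :
  compact [set: X] -> hausdorff_space X -> [set: X] !=set0 ->
  (forall n, closed (Z n)) -> exists x, forall n, Z n x -> interior (Z n) x.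
Proof.
move=> cX hX X0 Zcl.
pose good (U : set X) := open U /\ U !=set0.
have step n (U : set X) : exists U' : set X, good U -> good U' /\ (closure U' `<=` U /\
    (closure U' `<=` interior (Z n) \/ closure U' `<=` ~` Z n)).
  have [gU|] := pselect (good U); last by exists U.
  have shrink (V : set X) : good V -> exists2 U', good U' & closure U' `<=` V.
    move=> [oV [x Vx]].
    have [B Bx BV] := compact_regular hX cX (filterT : nbhs x setT) (open_nbhs_nbhs (conj oV Vx)).
    exists (interior B); first by split; [exact: open_interior|exists x].
    by apply: subset_trans BV; apply: closure_subset; exact: interior_subset.
  have [oU _] := gU.
  have [UZ|/existsNP[x /not_implyP[Ux Zx]]] := pselect (forall x, U x -> Z n x).
    have [U' gU' U'U] := shrink U gU; exists U' => _; split=> //; split=> //.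
    left; apply: subset_trans U'U _.
    by move=> x Ux; exact: filterS UZ (open_nbhs_nbhs (conj oU Ux)).
  have [|U' gU' U'U] := shrink (U `&` ~` Z n).
    by split; [apply: openI => //; exact: closed_openC|exists x].
  exists U' => _; split=> //; split; first by move=> y /U'U[].
  by right=> y /U'U[].
have [F hF] := choice (fun nU : nat * set X => step nU.1 nU.2).
pose U := fix U n := if n is m.+1 then F (m, U m) else setT.
have gU n : good (U n).
  elim: n => [|n IH]; first by split; [exact: openT|].
  exact: (hF (n, U n) IH).1.
have US n : closure (U n.+1) `<=` U n by exact: (hF (n, U n) (gU n)).2.1.
have Umono n m : (n <= m)%N -> U m `<=` U n.
  elim: m => [|m IH]; first by rewrite leqn0 => /eqP->.
  rewrite leq_eqVlt => /orP[/eqP->//|]; rewrite ltnS => /IH h.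
  by apply: subset_trans h; apply: subset_trans (US m); exact: subset_closure.
have Ff : ProperFilter (filter_from [set: nat] U).
  apply: filter_from_proper; last by move=> n _; exact: (gU n).2.
  apply: filter_from_filter; first by exists 0%N.
  move=> n m _ _; exists (maxn n m) => // x Ux.
  by split; apply: Umono Ux; rewrite ?leq_maxl ?leq_maxr.
have [x [_ xcl]] := cX _ Ff filterT; exists x => n Zx.
have xU : closure (U n.+1) x.
  by move=> B Bx; apply: xcl => //; exists n.+1.
have [_ [_ [h|h]]] := hF (n, U n) (gU n); first exact: h.
by have := h _ xU.
Qed.

Section Dynamics.
Variables (G : groupType) (X : topologicalType) (act : G -> X -> X).
Hypothesis act_cont : continuous_action act.
Hypothesis act_faithful : faithful_action act.
Hypothesis X_hausdorff : hausdorff_space X.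
Implicit Types (g h t : G) (x y : X) (U V W : set X).

Let act1 x : act 1%g x = x. Proof. by case: act_cont. Qed.
Let actM g h x : act (g * h)%g x = act g (act h x). Proof. by case: act_cont. Qed.
Let actC g : continuous (act g). Proof. by case: act_cont. Qed.
Let actgK g x : act (g^-1)%g (act g x) = x. Proof. exact: actK act1 actM g x. Qed.
Let actgKV g x : act g (act (g^-1)%g x) = x. Proof. exact: actKV act1 actM g x. Qed.

Lemma faithful_eq g h : (forall x, act g x = act h x) -> g = h.
Proof.
move=> gh; rewrite -[g](mulgVK h) (act_faithful (g := (g * h^-1)%g)) ?mul1g//.
by apply/seteqP; split=> // x _; rewrite /Fix/= actM gh actgKV.
Qed.

Lemma moved_point t : t != 1%g -> exists x, act t x <> x.
Proof.
move=> /eqP t1; apply: contrapT => /forallNP h; apply: t1; apply: act_faithful.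
by apply/seteqP; split=> // x _; apply: contrapT; exact: h.
Qed.

Lemma open_preimage_act g U : open U -> open (act g @^-1` U).
Proof. by move=> oU; apply: open_comp => // x _; exact: actC. Qed.

Lemma displaced_neighbourhood t x U : open U -> U x -> act t x <> x ->
  exists V, [/\ open V, V x, V `<=` U & forall y, V y -> ~ V (act t y)].
Proof.
move=> oU Ux tx; have := X_hausdorff; rewrite open_hausdorff => hX.
have [[A B] /= [xA xB] [oA oB /eqP AB]] := hX _ _ (introN eqP (nesym tx)).
rewrite !inE in xA xB.
exists (U `&` (A `&` act t @^-1` B)); split.
- by apply: openI => //; apply: openI => //; exact: open_preimage_act.
- by split.
- by move=> y [].
- move=> y [_ [_ By]] [_ [Ay _]].
  by have : set0 (act t y) by rewrite -AB; split.
Qed.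

Lemma closed_Fix t : closed (Fix act t).
Proof.
rewrite -openC openE => x tx.
have [V [oV Vx _ Vt]] := displaced_neighbourhood openT I tx.
apply: filterS (open_nbhs_nbhs (conj oV Vx)) => y Vy ty.
by have := Vt y Vy; rewrite ty.
Qed.

(** If [t] moves a point of an open set then, the space being Hausdorff, it moves
   a neighbourhood of that point off itself; both alternatives are inherited by
   smaller open sets. *)
Lemma fixed_or_displaced (F : seq G) U : open U -> U !=set0 ->
  exists V, [/\ open V, V !=set0, V `<=` U & forall t, t \in F ->
    (forall y, V y -> act t y = y) \/ (forall y, V y -> ~ V (act t y))].
Proof.
move=> oU U0; elim: F => [|t F [V [oV [x Vx] VU VF]]].
  by exists U; split.
have [Vt|/existsNP[y /not_implyP[Vy ty]]] :=
    pselect (forall y, V y -> act t y = y).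
  exists V; split=> //; first by exists x.
  by move=> s; rewrite inE => /orP[/eqP->|/VF]; [left|].
have [W [oW Wy WV Wt]] := displaced_neighbourhood oV Vy ty.
exists W; split=> //; first by exists y.
  exact: subset_trans WV VU.
move=> s; rewrite inE => /orP[/eqP->|/VF[h|h]]; first by right.
  by left=> z /WV; exact: h.
by right=> z /WV Vz /WV; exact: h.
Qed.

(** The rigid stabilizer of [V]. *)
Definition rigid V := [set g | forall y, ~ V y -> act g y = y].

Lemma rigid_subgroup V : is_subgroup (rigid V).
Proof.
split=> [y _|g h gV hV y Vy|g gV y Vy]; first exact: act1.
  by rewrite actM hV ?gV.
by rewrite -[in LHS](gV y Vy) actgK.
Qed.

Lemma rigid_preserves V g y : rigid V g -> V y -> V (act g y).
Proof.
move=> gV Vy; apply: contrapT => nV; apply: (nV).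
have := congr1 (act (g^-1)%g) (gV _ nV); rewrite !actgK => e.
by rewrite e.
Qed.

Lemma rigid_commute V W g h : (forall y, V y -> ~ W y) -> rigid V g -> rigid W h ->
  (g * h = h * g)%g.
Proof.
move=> VW gV hW; apply: faithful_eq => y; rewrite !actM.
have [Vy|Vy] := pselect (V y).
  by rewrite (hW y (VW _ Vy)) hW//; apply: VW; exact: rigid_preserves.
rewrite (gV y Vy); have [Wy|Wy] := pselect (W y); last by rewrite hW ?gV.
by apply: gV => Vh; apply: (VW _ Vh); exact: rigid_preserves.
Qed.

Lemma rigid_disjoint V W g : (forall y, V y -> ~ W y) -> rigid V g -> rigid W g ->
  g = 1%g.
Proof.
move=> VW gV gW; apply: faithful_eq => y; rewrite act1.
by have [/VW Wy|Vy] := pselect (V y); [exact: gW|exact: gV].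
Qed.

Lemma rigid_conj V t g : rigid V g -> rigid (act t @` V) (t * g * t^-1)%g.
Proof.
move=> gV y ty; rewrite !actM gV ?actgKV// => Vy; apply: ty.
by exists (act (t^-1)%g y); rewrite ?actgKV.
Qed.

Lemma rigid_centralizes_fixer V t g : (forall y, V y -> act t y = y) -> rigid V g ->
  (g * t * g^-1)%g = t.
Proof.
move=> tV gV; have tn : rigid (~` V) t by move=> y /contrapT; exact: tV.
have e := rigid_commute (fun y (Vy : V y) nVy => nVy Vy) gV tn.
by rewrite e -mulgA mulgV mulg1.
Qed.

Section Extreme.
Hypothesis act_minimal : minimal_action act.
Hypothesis act_proximal : extremely_proximal act.

Lemma compress_into (C V : set X) : closed C -> C <> setT -> open V -> V !=set0 ->
  exists k, forall y, C y -> V (act k y).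
Proof.
move=> cC CT oV V0; have [x hx] := act_proximal cC CT.
have [z [Vz [k _ kx]]] := act_minimal x V0 oV.
have [|g hg] := hx _ (open_preimage_act k oV); first by rewrite /preimage/= kx.
exists (k * g)%g => y Cy; rewrite actM.
by have := hg (act g y); apply; exists y.
Qed.

(** Compressing the complement of [W] into [V] conjugates the pointwise fixer of
   [W] into the rigid stabilizer of [V]. *)
Lemma fixer_conj_rigid V W : open V -> V !=set0 -> open W -> W !=set0 ->
  exists k, forall g, (forall y, W y -> act g y = y) -> rigid V (k * g * k^-1)%g.
Proof.
move=> oV V0 oW [w Ww].
have [|k hk] := compress_into (open_closedC oW) _ oV V0.
  by move=> WT; have : (~` W) w by rewrite WT.
exists k => g gW y Vy; rewrite !actM gW ?actgKV//.
by apply: contrapT => Wy; apply: Vy; rewrite -[y](actgKV k); exact: hk.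
Qed.

(** A nontrivial element fixing an open set pointwise has a conjugate supported
   inside that open set. *)
Lemma complementary_fixed_points : ~ topologically_free act ->
  exists g h, [/\ g <> 1%g, h <> 1%g & forall y, act g y = y \/ act h y = y].
Proof.
move=> /existsNP[g /not_implyP[g1 gint]].
have [x Ux] : interior (Fix act g) !=set0.
  by apply/set0P/eqP.
have fixU y : interior (Fix act g) y -> act g y = y by move/interior_subset.
have oU := @open_interior _ (Fix act g).
have [|k hk] := compress_into (open_closedC oU) _ oU (ex_intro _ x Ux).
  by move=> UT; have : (~` interior (Fix act g)) x by rewrite UT.
exists g, (k * g * k^-1)%g; split=> //.
  move=> e; apply: g1.
  by rewrite -[g](mulKg k) -[(k * g)%g](mulgVK k) e mul1g mulVg.
move=> y; have [gy|gy] := pselect (act g y = y); [by left|right].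
rewrite !actM fixU ?actgKV//; apply: contrapT => Uy.
by apply: gy; apply: fixU; rewrite -[y](actgKV k); exact: hk.
Qed.

(** At a generic point [x] the stabilizer is the directed union of the pointwise
   fixers of the neighbourhoods of [x], each of which is conjugate into
   [rigid V]. *)
Lemma rigid_not_almost_invariant (R : realType) V : countable [set: G] ->
  compact [set: X] -> (forall x, ~ amenable R (stabilizer act x)) ->
  open V -> V !=set0 -> ~ almost_invariant R (rigid V).
Proof.
move=> cG cX nam oV V0 aV; have [f finj] := countable_injP _ cG.
pose Z n := [set x | exists2 g, f g = n & act g x = x].
have ZE g : Z (f g) = Fix act g.
  apply/seteqP; split=> x; last by exists g.
  by move=> [h hg hx]; rewrite -(finj h g) ?inE.
have Zcl n : closed (Z n).
  have [[g <-]|ng] := pselect (exists g, f g = n); first by rewrite ZE; exact: closed_Fix.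
  rewrite (_ : Z n = set0); first exact: closed0.
  by apply/seteqP; split=> // x [g gn _]; apply: ng; exists g.
have X0 : [set: X] !=set0 by have [x _] := V0; exists x.
have [x xgen] := compact_generic_point cX X_hausdorff X0 Zcl.
apply: (nam x); apply: almost_invariant_amenable.
  exact: stabilizer_subgroup act1 actM x.
move=> S e e0 SH.
have [W [oW Wx WS]] : exists W, [/\ open W, W x &
    forall s, s \in S -> forall y, W y -> act s y = y].
  elim: S SH => [|s S IH] SH; first by exists setT; split=> //; exact: openT.
  have [|W [oW Wx WS]] := IH; first by move=> t tS; apply: SH; rewrite inE tS orbT.
  have xs : interior (Fix act s) x.
    by rewrite -ZE; apply: xgen; rewrite ZE; apply: SH; rewrite inE eqxx.
  exists (W `&` interior (Fix act s)); split=> //.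
    by apply: openI => //; exact: open_interior.
  move=> t; rewrite inE => /orP[/eqP->|tS] y [Wy /interior_subset//].
  by move=> _; exact: WS.
have [k hk] := fixer_conj_rigid oV V0 oW (ex_intro _ x Wx).
exact: (almost_invariant_conj hk aV) e0 WS.
Qed.

End Extreme.

Section AveragingFromRigid.
Variable R : realType.
Notation N := (@l2norm R G).

(** If [t] moves [U] off itself, then [g * t * g^-1] is [g * (t * g^-1 * t^-1)]
   followed on the right by [t], and the second factor commutes with [rigid U]
   because it is supported in the translate of [U] by [t]. *)
Lemma displaced_averaged U (gs : seq G) (e : R) t :
  (forall y, U y -> ~ U (act t y)) -> (forall g, g \in gs -> rigid U g) ->
  (forall f : ell2 R G, N (\sum_(g <- gs) lambda g f) <= e * (size gs)%:R * N f) ->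
  averaged gs e t.
Proof.
move=> tU gsU hgs f.
have UtU y : U y -> ~ (act t @` U) y by move=> Uy [z Uz zy]; apply: (tU z); rewrite ?zy.
have := @commuting_contraction R G (rigid U) (rigid (act t @` U))
  (rigid_subgroup _) (rigid_subgroup _)
  (fun a b => rigid_commute UtU) (fun a => rigid_disjoint UtU)
  gs (fun g => t * g^-1 * t^-1)%g _ _ hgs (lambda t f).
rewrite l2norm_lambda; under eq_bigr do rewrite -lambdaM !mulgA mulgVK.
apply; move=> g /gsU gU; split=> //; apply: rigid_conj.
by have [_ _] := rigid_subgroup U; apply.
Qed.

(** The elements which an average over [gs] does not treat are left alone by
   it, so they can be treated next, and a composition of averages treats
   everything. *)
Lemma rigid_averaging_property :
  (forall U, open U -> U !=set0 -> ~ almost_invariant R (rigid U)) ->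
  averaging_property R G.
Proof.
move=> naV F e e0; elim: {F}(size F) {-2}F (leqnn (size F)) => [|n IH] F Fn F1.
  by exists [:: 1%g] => //; case: F Fn F1.
have [F0|[t0 t0F]] : F = [::] \/ exists t, t \in F.
  by case: (F) => [|t r]; [left|right; exists t; rewrite mem_head].
  by exists [:: 1%g] => // t; rewrite F0.
have [x tx] := moved_point (F1 _ t0F).
have [U0 [oU0 U0x _ U0t]] := displaced_neighbourhood openT I tx.
have [U [oU UN UU0 UF]] := fixed_or_displaced F oU0 (ex_intro _ x U0x).
have [gs [gs0 gsU hgs]] :=
  not_almost_invariant_contracting (rigid_subgroup U) (naV U oU UN) e0.
have t0av : averaged gs e t0.
  by apply: displaced_averaged gsU hgs => y /UU0 Uy /UU0; exact: U0t.
have alt t : t \in F -> averaged gs e t \/ forall g, g \in gs -> (g * t * g^-1)%g = t.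
  move=> /UF[tfix|tdis]; [right|left]; last exact: displaced_averaged tdis gsU hgs.
  by move=> g /gsU; exact: rigid_centralizes_fixer.
pose F' := [seq t <- F | ~~ `[< averaged gs e t >]].
have [||hs hs0 hhs] := IH F'.
- rewrite -ltnS; apply: leq_trans Fn; rewrite size_filter.
  rewrite -(count_predC (fun t => `[< averaged gs e t >]) F) -[X in (X < _)%N]add0n.
  rewrite ltn_add2r -has_count; apply/hasP; exists t0 => //; exact/asboolP.
- by move=> t; rewrite mem_filter => /andP[_ /F1].
exists [seq (h * g)%g | h <- hs, g <- gs]; first by rewrite size_allpairs muln_gt0 hs0.
move=> t tF f; rewrite big_allpairs_dep size_allpairs.
have cj h g : lambda (h * g * t * (h * g)^-1) f =
    lambda h (lambda (g * t * g^-1) (lambda h^-1 f)).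
  by rewrite -!lambdaM; congr lambda; rewrite invgM !mulgA.
under eq_bigr do under eq_bigr do rewrite cj.
have [tav|tnav] := pselect (averaged gs e t).
  apply: le_trans (ler_l2norm_sum _ _) _.
  apply: (@le_trans _ _ (\sum_(h <- hs) e * (size gs)%:R * N f)).
    apply: ler_sum => h _; rewrite -linear_sum l2norm_lambda.
    by apply: le_trans (tav _) _; rewrite l2norm_lambda.
  rewrite big_const_seq count_predT iter_addr_0 -[leLHS]mulr_natr natrM.
  by rewrite le_eqVlt; apply/orP; left; apply/eqP; ring.
have [//|tfix] := alt t tF.
have tF' : t \in F' by rewrite mem_filter tF andbT; apply/negP => /asboolP.
have -> : \sum_(h <- hs) \sum_(g <- gs) lambda h (lambda (g * t * g^-1) (lambda h^-1 f)) =
    \sum_(h <- hs) lambda (h * t * h^-1) f *+ size gs.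
  apply: eq_bigr => h _; rewrite big_seq.
  rewrite (eq_bigr (fun=> lambda (h * t * h^-1) f)).
    by rewrite -big_seq big_const_seq count_predT iter_addr_0.
  by move=> g /tfix->; rewrite !lambdaM.
rewrite sumrMnl -scaler_nat l2normZ -(rmorph_nat (real_complex R)) normc_real.
rewrite ger0_norm// natrM.
have -> : e * ((size hs)%:R * (size gs)%:R) * N f =
  (size gs)%:R * (e * (size hs)%:R * N f) by ring.
by rewrite ler_wpM2l//; exact: hhs.
Qed.

End AveragingFromRigid.

Section FreeCase.
Variable R : realType.
Hypothesis act_minimal : minimal_action act.
Hypothesis act_proximal : extremely_proximal act.
Notation N := (@l2norm R G).

(** An isolated point would allow to compress its complement, injectively, into
   a single point. *)
Lemma open_two_points V : ~ ([set: X] #= `I_2)%card -> open V -> V !=set0 ->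
  (exists t : G, t != 1%g) -> exists x y, [/\ V x, V y & x <> y].
Proof.
move=> X2 oV [v Vv] [t t1]; apply: contrapT => h.
have V1 y : V y -> y = v.
  by move=> Vy; apply: contrapT => yv; apply: h; exists y, v.
have [|k hk] := compress_into act_minimal act_proximal (open_closedC oV) _ oV (ex_intro _ v Vv).
  by move=> VT; have : (~` V) v by rewrite VT.
have C1 y z : y <> v -> z <> v -> y = z.
  move=> yv zv; have kC w : w <> v -> act k w = v.
    by move=> wv; apply: (V1); apply: hk => Vw; apply: wv; exact: V1.
  by rewrite -[y](actgK k) -[z](actgK k) !kC.
have [x tx] := moved_point t1.
have [w wv] : exists w, w <> v.
  have [xv|xv] := pselect (x = v); last by exists x.
  by exists (act t x); rewrite xv in tx *.
apply: X2; apply/card_set_bijP.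
exists (fun y => if `[< y = v >] then 0%N else 1%N); split.
- by move=> y _ /=; case: ifP.
- move=> y z _ _ /=; case: asboolP => [->|yv]; case: asboolP => [->|zv] // _.
  exact: C1.
- move=> [|[|//]] _ /=; first by exists v => //; case: asboolP.
  by exists w => //; case: asboolP.
Qed.

(** Two points of an open set have disjoint neighbourhoods, and splitting one of
   these again and again yields any number of disjoint open sets. *)
Lemma disjoint_opens (n : nat) V : ~ ([set: X] #= `I_2)%card -> open V -> V !=set0 ->
  (exists t : G, t != 1%g) -> exists W : nat -> set X,
  (forall i, open (W i) /\ W i !=set0) /\
  (forall i, W i `<=` V) /\
  (forall i j y, (i < j < n)%N -> W i y -> W j y -> False).
Proof.
move=> X2 oV V0 t1; elim: n V oV V0 => [|n IH] V oV V0.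
  by exists (fun=> V); split; [|split] => [i|i|i j y /andP[]//]; [split|].
have [x [y [Vx Vy xy]]] := open_two_points X2 oV V0 t1.
have := X_hausdorff; rewrite open_hausdorff => hX.
have [[A B] /= [xA yB] [oA oB /eqP AB]] := hX _ _ (introN eqP xy).
rewrite !inE in xA yB.
have oVA := openI oV oA; have oVB := openI oV oB.
have [||W [Wo [WV Wd]]] := IH (V `&` B); [by []|by exists y|].
exists (fun i => if i is j.+1 then W j else V `&` A); split.
  by case=> [|i]; [split=> //; exists x|exact: Wo].
split; first by case=> [|i] z; [case|move=> /WV[]].
move=> [|i] [|j] z //=; last exact: Wd.
move=> _ [_ Az] /WV[_ Bz].
by have : set0 z by rewrite -AB.
Qed.

Lemma free_averaging_property : ~ ([set: X] #= `I_2)%card ->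
  topologically_free act -> averaging_property R G.
Proof.
move=> X2 free F e e0 F1.
have [F0|[t0 t0F]] : F = [::] \/ exists t, t \in F.
  by case: (F) => [|t r]; [left|right; exists t; rewrite mem_head].
  by exists [:: 1%g] => // t; rewrite F0.
have [x tx] := moved_point (F1 _ t0F).
have [U [oU [x0 Ux0] _ UF]] := fixed_or_displaced F openT (ex_intro _ x I).
have {UF}UF t : t \in F -> forall y, U y -> ~ U (act t y).
  move=> tF; have [tfix|//] := UF t tF.
  have : interior (Fix act t) x0 by exact: filterS tfix (open_nbhs_nbhs (conj oU Ux0)).
  by rewrite free//; exact/eqP/F1.
(* Powers' bound [2 * sqrt n] falls below [e * n] once [n] exceeds [(2 / e)^2]. *)
pose n := (Num.truncn ((2 / e) ^+ 2)).+1.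
have ne : 2 * Num.sqrt n%:R <= e * n%:R :> R.
  have n0 : 0 <= n%:R :> R by [].
  have h : (2 / e) ^+ 2 <= n%:R by apply/ltW; exact: truncnS_gt.
  rewrite -[X in e * X](sqr_sqrtr n0) expr2 mulrA ler_wpM2r ?sqrtr_ge0//.
  rewrite mulrC -ler_pdivrMr// -(@ler_pXn2r _ 2)// ?nnegrE ?sqrtr_ge0//.
    by rewrite sqr_sqrtr.
  by rewrite divr_ge0// ltW.
have t1 : exists t : G, t != 1%g by exists t0; exact: F1.
have [W [Wo [_ Wd]]] := disjoint_opens n X2 openT (ex_intro _ x I) t1.
have [|g hg] := @choice nat G (fun i k => forall y, ~ U y -> W i (act k y)).
  move=> i; have [oW W0] := Wo i.
  apply: (compress_into act_minimal act_proximal (open_closedC oU)) => //.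
  by move=> UT; have : (~` U) x0 by rewrite UT.
(* The estimate needs a partition of [G]; it is read off from the orbit of a
   point [x0] of [U]. *)
exists [seq g i | i <- iota 0 n]; first by rewrite size_map size_iota.
move=> t tF f; rewrite big_map size_map size_iota.
have -> : \sum_(i <- iota 0 n) lambda (g i * t * (g i)^-1) f =
  \sum_(i < n) lambda (g i * t * (g i)^-1) f 
  by rewrite -(big_mkord xpredT (fun i => lambda (g i * t * (g i)^-1) f)) /index_iota subn0.
apply: (@le_trans _ _ (2 * Num.sqrt n%:R * N f)); last by rewrite ler_wpM2r.
apply: (@powers_estimate R G n g [set a | ~ U (act a x0)]) => /=.
  move=> a; have [Ua|Ua] := pselect (U (act a x0)); [right|by left].
  by move=> Uta; apply: (UF t tF _ Uta); rewrite -actM mulVKg.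
move=> i j a ij Ui Uj; apply: (Wd i j (act a x0) ij).
  by have := hg i _ Ui; rewrite -actM mulVKg.
by have := hg j _ Uj; rewrite -actM mulVKg.
Qed.

End FreeCase.
End Dynamics.

Theorem theorem1p4 (R : realType) (G : groupType) (X : topologicalType)
    (act : G -> X -> X)
    (Gcountable : countable [set: G])
    (act_cont : continuous_action act)
    (act_faithful : faithful_action act)
    (act_extreme : extreme_boundary act)
    (X_hausdorff : hausdorff_space X)
    (X_not_two : ~ ([set: X] #= `I_2)%card) :
  Cstar_simple R G <->
    topologically_free act \/
    (forall x : X, ~ amenable R (stabilizer act x)).
Proof.
have [cX mX pX] := act_extreme; have [act1 actM _] := act_cont.
split=> [simple|[free|nam]].
- have [free|nfree] := pselect (topologically_free act); [by left|right=> x ax].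
  have [g [h [g1 h1 gh]]] := complementary_fixed_points act_cont mX pX nfree.
  exact: (amenable_stabilizer_not_simple act1 actM ax g1 h1 gh).
- apply: averaging_Cstar_simple.
  exact: (free_averaging_property act_cont act_faithful X_hausdorff mX pX).
- apply: averaging_Cstar_simple.
  apply: (rigid_averaging_property act_cont act_faithful X_hausdorff) => U oU U0.
  exact: (rigid_not_almost_invariant act_cont X_hausdorff mX pX).
Qed.
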